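(* Let $K$ be a field of characteristic $0$ and let $S=K[x_1,\dots,x_n]$ be the standard graded polynomial ring. Let $I\subset S$ and $J\subset S$ be homogeneous ideals such that the generic initial ideal $\mathrm{Gin}_{\mathrm{lex}}(J)$ is a lex ideal. Then for a general change of coordinates $g\in GL_n(K)$, $$H(I\cap g(J),d)\le H(I^{\mathrm{lex}}\cap J^{\mathrm{oplex}},d)\quad\text{for all } d\ge 0.$$
   Context: $H(M,d)=\dim_K M_d$ denotes the Hilbert function of a finitely generated graded $S$-module $M$. Each $h=(a_{ij})\in GL_n(K)$ is identified with the $K$-algebra automorphism (change of coordinates) of $S$ given by $h(x_i)=\sum_{j=1}^n a_{ji}x_j$. A property holds for a general $g\in GL_n(K)$ if there is a non-empty Zariski open subset $U\subset GL_n(K)$ such that it holds for all $g\in U$. Let $>_{\mathrm{lex}}$ be the lexicographic order induced by $x_1>\cdots>x_n$ and $>_{\mathrm{oplex}}$ the lexicographic order induced by $x_n>\cdots>x_1$. A set $W$ of monomials of $S$ is lex (resp. opposite lex) if for all monomials $u,v$ of the same degree, $u\in W$ and $v>_{\mathrm{lex}}u$ (resp. $v>_{\mathrm{oplex}}u$) imply $v\in W$. A monomial ideal is a lex ideal (resp. opposite lex ideal) if its set of monomials is lex (resp. opposite lex). For a homogeneous ideal $I\subset S$, $I^{\mathrm{lex}}$ (resp. $I^{\mathrm{oplex}}$) denotes the unique lex (resp. opposite lex) ideal with the same Hilbert function as $I$ (it exists by Macaulay's theorem). $\mathrm{Gin}_\sigma(I)$ denotes the generic initial ideal of $I$ with respect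 to a term order $>_\sigma$, i.e. the common value of $\mathrm{in}_\sigma(g(I))$ for general $g\in GL_n(K)$. *)

(* Defs.v *)
From Stdlib Require Import ClassicalEpsilon.
From HB Require Import structures.
From mathcomp Require Import all_boot all_order all_algebra.
From mathcomp Require Import mpoly.

Set Implicit Arguments.
Unset Strict Implicit.
Unset Printing Implicit Defensive.

Import GRing.Theory.
Local Open Scope ring_scope.

Definition is_basis (K : fieldType) (V : lmodType K) (P : V -> Prop)
    (k : nat) (e : k.-tuple V) : Prop :=
  (forall i, P (tnth e i)) /\
  (forall v, P v -> exists! c : 'rV[K]_k, v = \sum_(i < k) c 0 i *: tnth e i).

(* Meaningful only when P is a finite-dimensional subspace; unspecified
   otherwise. *)
Definition dimension (K : fieldType) (V : lmodType K) (P : V -> Prop) : nat :=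
  epsilon (inhabits 0%N) (fun k => exists e : k.-tuple V, is_basis P e).

Section Ideals.
Variables (n : nat) (K : fieldType).
Local Notation S := {mpoly K[n]}.
Implicit Types (I J L : S -> Prop) (d : nat).

Definition is_ideal I : Prop :=
  [/\ I 0, forall p q, I p -> I q -> I (p + q) & forall p q, I q -> I (p * q)].

Definition homogeneous_ideal I : Prop :=
  is_ideal I /\ forall p d, I p -> I (pihomog mdeg d p).

Definition ideal_inter I J : S -> Prop := fun p => I p /\ J p.

Definition ideal_gen (G : S -> Prop) : S -> Prop :=
  fun p => forall I, is_ideal I -> (forall q, G q -> I q) -> I p.

Definition same_ideal I J : Prop := forall p, I p <-> J p.

Definition hilbert I d : nat := dimension (fun p => I p /\ p \is d.-homog).

Definition coord_change (h : 'M[K]_n) (p : S) : S :=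
  p \mPo [tuple \sum_(j < n) h j i *: 'X_j | i < n].

Definition ideal_image (h : 'M[K]_n) I : S -> Prop :=
  fun p => exists2 q, I q & p = coord_change h q.

(* The polynomials in F are in the n * n matrix entries.  Allowing powers of
   1 / det as well would give the same open subsets of GL_n. *)
Definition zariski_open (U : 'M[K]_n -> Prop) : Prop :=
  exists F : {mpoly K[n * n]} -> Prop, forall g,
    U g <-> g \in unitmx /\ exists2 f, F f & f.@[fun k => mxvec g 0 k] != 0.

Definition for_general (P : 'M[K]_n -> Prop) : Prop :=
  exists U, [/\ zariski_open U, exists g, U g & forall g, U g -> P g].

(* The first variable is 'X_0, so x_1 > ... > x_n reads 'X_0 > ... > 'X_(n-1). *)
Definition lex_gt : rel 'X_{1..n} := fun u v =>
  [exists i : 'I_n, (v i < u i)%N && [forall j : 'I_n, (j < i)%N ==> (u j == v j)]].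

Definition oplex_gt : rel 'X_{1..n} := fun u v =>
  [exists i : 'I_n, (v i < u i)%N && [forall j : 'I_n, (i < j)%N ==> (u j == v j)]].

Definition is_lead_monomial (gt : rel 'X_{1..n}) (p : S) (m : 'X_{1..n}) : Prop :=
  m \in msupp p /\ forall m', m' \in msupp p -> m' != m -> gt m m'.

Definition initial_ideal (gt : rel 'X_{1..n}) I : S -> Prop :=
  ideal_gen (fun q => exists p m,
    [/\ I p, is_lead_monomial gt p m & q = 'X_[m]]).

Definition is_gin (gt : rel 'X_{1..n}) I L : Prop :=
  for_general (fun g => same_ideal (initial_ideal gt (ideal_image g I)) L).

Definition monomial_ideal I : Prop :=
  exists W : 'X_{1..n} -> Prop,
    same_ideal I (ideal_gen (fun q => exists2 m, W m & q = 'X_[m])).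

Definition segment_set (gt : rel 'X_{1..n}) (W : 'X_{1..n} -> Prop) : Prop :=
  forall u v, mdeg u = mdeg v -> W u -> gt v u -> W v.

Definition segment_ideal (gt : rel 'X_{1..n}) I : Prop :=
  monomial_ideal I /\ segment_set gt (fun m => I 'X_[m]).

Definition is_lex_ideal I : Prop := segment_ideal lex_gt I.
Definition is_oplex_ideal I : Prop := segment_ideal oplex_gt I.

(* "L is I^lex" and "L is I^oplex"; such an L is unique, and exists for
   homogeneous I by Macaulay's theorem. *)
Definition is_lexification I L : Prop :=
  is_lex_ideal L /\ forall d, hilbert L d = hilbert I d.
Definition is_oplexification I L : Prop :=
  is_oplex_ideal L /\ forall d, hilbert L d = hilbert I d.

End Ideals.

(* Main.v *)
Require Import Defs.
From HB Require Import structures.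
From mathcomp Require Import all_boot all_order all_algebra.
From mathcomp Require Import zify.
From mathcomp Require Import mpoly.
From Stdlib Require Import Classical_Prop ClassicalEpsilon.
Import GRing.Theory.
Set Implicit Arguments.
Unset Strict Implicit.
Unset Printing Implicit Defensive.

(* A degeneration of V or of W inside its GL_n-orbit closure can only raise the dimension of
   a general intersection V /\ gW.  So in each degree I_d may be replaced by the span of a
   strongly stable set A of monomials (Galligo, characteristic 0) and, since Gin_lex(J) is
   lex, J_d by the monomials B of J^oplex.  Evaluating at g = 1 it remains to see that lex
   segments L minimise #(A \ B) among strongly stable sets A of a given size, when B is an
   opposite lex segment.  This is an induction on the number of variables which compares,
   for each k, the monomials whose exponent in the last variable is at most k.

   Each degree requires an open condition on g, but finitely many degrees suffice: the lower
   bounds dim (I + gJ)_d >= dim (I^lex + J^oplex)_d are the sizes of lex segments which,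
   by Dickson's lemma, grow minimally from some degree on, and from there Macaulay's bound
   propagates the inequality. *)

(** * Monomials as exponent lists, lex segments and strongly stable sets *)

(* The head of a list is the exponent of the last variable, so that induction on lists
   removes the smallest variable for the lexicographic order. *)

(** The intersection is bounded above through the sum: when the dimensions of both spaces are known,
    this amounts to a lower bound on [\rank (V + W *m rho d g)]. Such a bound passes from a limit to
    members of the family and is an open condition on [g]. The obstacle in the combinatorial half is
    that a slice of a lex segment by the last exponent can be larger than the same slice of a stable
    set of equal size; only the partial sums compare. That comparison rests on Macaulay's growth
    bound in one variable fewer, and the growth bound rests on the first partial sum, so the two
    advance together by induction on the number of variables. A single initial space need not be
    stable. The stable set is reached by repeating a shear followed by a degeneration for the degree
    reverse lexicographic order, until a bounded measure stops growing. The same limits extend the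
    growth bound from stable sets to arbitrary spaces of forms, which is what the passage between
    degrees uses. *)

Fixpoint deg (l : seq nat) : nat := if l is k :: s then k + deg s else 0.

Fixpoint mons (n d : nat) : seq (seq nat) :=
  if n is n'.+1 then flatten [seq map (cons k) (mons n' (d - k)) | k <- iota 0 d.+1]
  else if d is 0 then [:: [::]] else [::].

Definition cnt n d (A : pred (seq nat)) := count A (mons n d).

Lemma monsS n d :
  mons n.+1 d = flatten [seq map (cons k) (mons n (d - k)) | k <- iota 0 d.+1].
Proof. by []. Qed.

Lemma mem_mons n d (l : seq nat) : (l \in mons n d) = (size l == n) && (deg l == d).
Proof.
elim: n d l => [|n IHn] d l; first by case: d => [|d]; case: l => [|a l].
rewrite monsS; move: (iota 0 d.+1) (mem_iota 0 d.+1) => t tP; apply/flatten_mapP/idP => [[k]|].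
  by rewrite tP => kd /mapP[m]; rewrite IHn => /andP[/eqP <- /eqP md] ->;
    rewrite /= eqxx /= md; lia.
case: l => [//|k m] /= /andP[/eqP sm /eqP dm]; exists k; first by rewrite tP; lia.
by apply/mapP; exists m => //; rewrite IHn -dm addKn eqxx; case: sm => ->; rewrite eqxx.
Qed.

Lemma mons_size n d l : l \in mons n d -> size l = n.
Proof. by rewrite mem_mons => /andP[/eqP]. Qed.

Lemma mons_sum n d l : l \in mons n d -> deg l = d.
Proof. by rewrite mem_mons => /andP[_ /eqP]. Qed.

Lemma mons_cons n d k l : k <= d -> ((k :: l) \in mons n.+1 d) = (l \in mons n (d - k)).
Proof. by move=> kd; rewrite !mem_mons /= eqSS; congr andb; apply/eqP/eqP; lia. Qed.

Lemma mons_uniq n d : uniq (mons n d).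
Proof.
elim: n d => [|n IHn] d; first by case: d.
rewrite monsS; move: (iota 0 d.+1) (iota_uniq 0 d.+1); elim=> [//|k s IHs] /= /andP[ks us].
rewrite cat_uniq map_inj_uniq; last by move=> x y [].
rewrite IHn IHs // andbT /=.
apply/hasPn => l /flatten_mapP[j js /mapP[m _ ->]]; apply/mapP => -[m' _ [jk _]].
by rewrite jk (negPf ks) in js.
Qed.

Lemma cntS n d A : cnt n.+1 d A = \sum_(0 <= k < d.+1) cnt n (d - k) (fun m => A (k :: m)).
Proof.
rewrite /cnt monsS (count_flatten [seq map (cons k) (mons n (d - k)) | k <- iota 0 d.+1] A).
rewrite -map_comp sumnE big_map /index_iota subn0.
by apply: eq_bigr => k _; rewrite /= count_map.
Qed.

Lemma cnt_sub n d (A B : pred (seq nat)) :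
  {in mons n d, forall l, A l -> B l} -> cnt n d A <= cnt n d B.
Proof.
rewrite /cnt; elim: (mons n d) => [//|a s IH] sAB /=; apply: leq_add.
  by have := sAB a (mem_head _ _); case: (A a) => // ->.
by apply: IH => l ls; apply: sAB; rewrite inE ls orbT.
Qed.

Lemma cnt_eq n d (A B : pred (seq nat)) :
  {in mons n d, forall l, A l = B l} -> cnt n d A = cnt n d B.
Proof. by move=> AB; apply: eq_in_count. Qed.

Lemma cnt_ltn n d (A B : pred (seq nat)) u :
  {in mons n d, forall l, A l -> B l} -> u \in mons n d -> B u -> ~~ A u ->
  cnt n d A < cnt n d B.
Proof.
move=> sAB um Bu nAu.
have := cnt_sub (A := fun l => A l || (l == u)) (B := B) (n := n) (d := d) _.
have -> : cnt n d (fun l => A l || (l == u)) = (cnt n d A).+1.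
  have := count_predUI A (pred1 u) (mons n d).
  rewrite (count_uniq_mem _ (mons_uniq n d)) um addn1 => <-.
  rewrite [X in _ + X](eq_count (a2 := pred0)) ?count_pred0 ?addn0 //.
  by move=> l /=; apply/negP => /andP[Al /eqP lu]; rewrite lu (negPf nAu) in Al.
by apply=> l lm /orP[/sAB-> //|/eqP->].
Qed.

Lemma cntIC n d (A B : pred (seq nat)) :
  cnt n d A = cnt n d (predI A B) + cnt n d (predI A (predC B)).
Proof.
rewrite /cnt; elim: (mons n d) => //= a s ->.
by case: (A a); case: (B a) => /=; lia.
Qed.

(** Tails are compared first because the end of a list holds the exponent of the largest variable.
    Inside one degree heads never decide: equal tails force equal heads. *)
Fixpoint lgt (l l' : seq nat) : bool :=
  match l, l' with
  | a :: s, b :: s' => lgt s s' || ((s == s') && (b < a))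
  | _, _ => false
  end.

Lemma lgt_irr l : lgt l l = false.
Proof. by elim: l => //= a s ->; rewrite ltnn andbF. Qed.

Lemma lgt_trans : transitive lgt.
Proof.
move=> y x z; elim: x y z => [|a x IH] [|b y] [|c z] //=.
case/orP => [xy|/andP[/eqP-> ba]]; case/orP => [yz|/andP[/eqP<- cb]].
- by rewrite (IH _ _ xy yz).
- by rewrite xy.
- by rewrite yz.
- by rewrite eqxx (ltn_trans cb ba) orbT.
Qed.

Lemma lgt_total l l' : size l = size l' -> [|| l == l', lgt l l' | lgt l' l].
Proof.
elim: l l' => [|a s IH] [|b s'] //= [ss]; rewrite eqseq_cons.
by case/or3P: (IH _ ss) => [/eqP->|->|->]; rewrite ?eqxx ?orbT ?andbT //=;
  case: (ltngtP a b); rewrite ?orbT.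
Qed.

Lemma lgt_mons_total n d l l' : l \in mons n d -> l' \in mons n d ->
  [|| l == l', lgt l l' | lgt l' l].
Proof. by move=> lm l'm; apply: lgt_total; rewrite (mons_size lm) (mons_size l'm). Qed.

Lemma lgt_cons_mons n d a b s s' : (a :: s) \in mons n d -> (b :: s') \in mons n d ->
  lgt (a :: s) (b :: s') = lgt s s'.
Proof.
move=> /mons_sum sa /mons_sum sb; move: sa sb => /= sa sb.
case: eqP => [ss|_]; last by rewrite orbF.
by rewrite -ss in sb; (have -> : (b < a) = false by lia); rewrite /= orbF.
Qed.

Definition lexset n d (L : pred (seq nat)) :=
  forall l l', l \in mons n d -> l' \in mons n d -> lgt l' l -> L l -> L l'.

(** The order being total, a monomial of [L] outside [L'] lies below every member of [L']; then [L']
    is a proper part of [L], against the sizes. *)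
Lemma lexset_sub n d L L' : lexset n d L -> lexset n d L' -> cnt n d L <= cnt n d L' ->
  {in mons n d, forall l, L l -> L' l}.
Proof.
move=> lL lL' LL' l lm Ll; apply/negPn/negP => nL'l.
move: LL'; rewrite leqNgt => /negP; apply; apply: (cnt_ltn _ lm Ll nL'l) => m mm L'm.
have /or3P[/eqP E|lg|lg] : [|| l == m, lgt l m | lgt m l].
- exact: lgt_mons_total lm mm.
- by rewrite -E.
- by rewrite (lL' m l) in nL'l.
- exact: (lL l m).
Qed.

(* [lgt] is total on [mons n d], so sorting by it lists the monomials from the
   lexicographically largest one down. *)
Definition lexseg n d c : pred (seq nat) :=
  fun l => l \in take c (sort (fun a b => (a == b) || lgt a b) (mons n d)).

Lemma cnt_lexseg n d c : c <= size (mons n d) -> cnt n d (lexseg n d c) = c.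
Proof.
move=> cN; rewrite /cnt /lexseg; set s := sort _ _.
have us : uniq s by rewrite sort_uniq mons_uniq.
have ps : perm_eq s (mons n d) by rewrite perm_sort.
pose p : pred (seq nat) := fun l => l \in take c s.
rewrite -(permP ps) -[LHS]/(count p s) -(cat_take_drop c s) count_cat.
have -> : count p (drop c s) = 0.
  apply/eqP; rewrite -leqn0 leqNgt -has_count; apply/hasPn => l ld /=.
  move: us; rewrite -{1}(cat_take_drop c s) cat_uniq => /and3P[_ /hasPn h _].
  exact: h.
rewrite addn0; have : all p (take c s) by apply/allP.
by rewrite all_count => /eqP->; rewrite size_take (perm_size ps) ; case: ltngtP cN.
Qed.

Lemma lexseg_lexset n d c : lexset n d (lexseg n d c).
Proof.
move=> l l' lm l'm ll'; rewrite /lexseg; set e := (fun a b => _).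
have se : sorted e (sort e (mons n d)).
  apply: (sort_sorted_in (P := mem (mons n d))); last by apply/allP.
  move=> x y xm ym; rewrite /e.
  by case/or3P: (lgt_mons_total xm ym) => [/eqP->|->|->]; rewrite ?eqxx ?orbT.
have te : transitive e.
  move=> y x z /orP[/eqP->//|xy] /orP[/eqP<-|yz]; first by rewrite /e xy orbT.
  by rewrite /e (lgt_trans xy yz) orbT.
set s := sort _ _ in se *; move=> lt.
have l's : l' \in s by rewrite mem_sort.
rewrite -(cat_take_drop c s) mem_cat in l's.
case/orP: l's => // l'd; move: se; rewrite -(cat_take_drop c s) sorted_pairwise // pairwise_cat.
case/and3P => /allrelP /(_ _ _ lt l'd) /orP[/eqP E|ge] _ _; first by rewrite E lgt_irr in ll'.
by have := lgt_trans ge ll'; rewrite lgt_irr.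
Qed.

Lemma cnt_le_size n d A : cnt n d A <= size (mons n d).
Proof. exact: count_size. Qed.

(* Divides a monomial by the last variable occurring in it. *)
Fixpoint red (l : seq nat) : seq nat :=
  match l with
  | 0 :: s => 0 :: red s
  | k.+1 :: s => k :: s
  | [::] => [::]
  end.

Lemma size_red l : size (red l) = size l.
Proof. by elim: l => [//|[|k] s IH] //=; rewrite IH. Qed.

Lemma deg_red l : deg (red l) = (deg l).-1.
Proof. by elim: l => [//|[|k] s IH] //=. Qed.

Lemma red_mons n d l : l \in mons n d.+1 -> red l \in mons n d.
Proof. by rewrite !mem_mons size_red deg_red => /andP[-> /eqP->] /=. Qed.

Lemma cnt_redS n d A : cnt n.+1 d.+1 (fun l => A (red l)) =
  cnt n d.+1 (fun l => A (0 :: red l)) + cnt n.+1 d A.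
Proof.
by rewrite !cntS big_nat_recl //; congr (_ + _).
Qed.

Definition lge l l' := (l == l') || lgt l l'.

(** When [k'] is 0 the gap in degree passes to the tails; if the reduced tail then equals [r], the
    degrees leave no room for a positive [k]. *)
Lemma lge_red s' s : lgt s' s -> deg s < deg s' -> lge (red s') s.
Proof.
elim: s' s => [|k' r' IH] [|k r] //=; rewrite /lge.
case: k' => [|k'] /=.
  rewrite ltn0 andbF orbF => rr sm.
  have /orP[/eqP E|g] : lge (red r') r by apply: IH => //; lia.
    have := deg_red r'; rewrite E eqseq_cons eqxx andbT => E2.
    by have -> : 0 == k by apply/eqP; lia.
  by rewrite g orbT.
case/orP => [->|/andP[/eqP-> kk]] _; first by rewrite orbT.
by rewrite eqseq_cons eqxx /= lgt_irr /= andbT; lia.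
Qed.

Lemma lgt_red l : 0 < deg l -> lgt l (red l).
Proof.
elim: l => [//|[|k] s IH] /= h; first by rewrite IH.
by rewrite eqxx ltnSn orbT.
Qed.

Lemma red_mono s' s : lge s' s -> deg s' = deg s -> lge (red s') (red s).
Proof.
elim: s' s => [|k' r' IH] [|k r] //= h sm.
case: (eqVneq (k' :: r') (k :: r)) h => [[-> ->] _|ne]; first by rewrite /lge eqxx.
rewrite /lge (negPf ne) /= => {ne} h.
have {}h : lgt r' r.
  by case/orP: h => [//|/andP[/eqP E kk]]; move: sm; rewrite E; lia.
case: k k' sm => [|k] [|k'] sm /=.
- have /orP[/eqP->|->] : lge (red r') (red r) by apply: IH => //; rewrite /lge h orbT.
    by rewrite eqxx.
  by rewrite orbT.
- by rewrite (lgt_trans h) ?orbT //; apply: lgt_red; lia.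
- case/orP: (@lge_red r' r h ltac:(lia)) => [/eqP E|->]; last by rewrite orbT.
  have := deg_red r'; rewrite E eqseq_cons eqxx andbT => E2.
  by have -> : 0 == k by apply/eqP; lia.
- by rewrite h orbT.
Qed.

Lemma lexset_red n d L : lexset n d L -> lexset n d.+1 (fun l => L (red l)).
Proof.
move=> lL l l' lm l'm ll' /=.
have /orP[/eqP-> //|g] : lge (red l') (red l).
  by apply: red_mono; rewrite /lge ?ll' ?orbT // (mons_sum lm) (mons_sum l'm).
by apply: lL => //; apply: red_mons.
Qed.

(* Moving one unit to the next list entry replaces a variable by the next larger one. *)
Inductive step : seq nat -> seq nat -> Prop :=
| step_here e f s : step (e.+1 :: f :: s) (e :: f.+1 :: s)
| step_there k s s' : step s s' -> step (k :: s) (k :: s').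

(** * Strongly stable sets: growth and slices by the last exponent *)

Definition stable (A : pred (seq nat)) := forall l l', step l l' -> A l -> A l'.

Lemma stable_tail A k : stable A -> stable (fun l => A (k :: l)).
Proof. by move=> sA l l' ll'; apply: sA; constructor. Qed.

(** The unit taken from the head is carried by steps through the zeros of [m] to its first nonzero
    entry, the one that [red] lowered. *)
Lemma stable_red A j m : stable A -> 0 < deg m -> A (j.+1 :: red m) -> A (j :: m).
Proof.
elim: m A j => [//|[|k] s IH] A j sA sm /=; last by apply: sA; constructor.
move=> h; apply: (IH (fun l => A (j :: l)) 0) => //; first exact: stable_tail.
by apply: sA h; constructor.
Qed.

(** For a stable [A], [fun l => A (red l)] selects the monomials of degree [d.+1] in the ideal
    generated by [A], so this is Macaulay's bound for stable sets. *)
Definition growth_at n := forall d A L, stable A -> lexset n d L -> cnt n d L <= cnt n d A ->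
  cnt n d.+1 (fun l => L (red l)) <= cnt n d.+1 (fun l => A (red l)).

Lemma lexset_tail n d k L : k <= d -> lexset n.+1 d L -> lexset n (d - k) (fun l => L (k :: l)).
Proof.
move=> kd lL l l' lm l'm ll'; apply: lL; rewrite ?mons_cons //=.
by rewrite ll'.
Qed.

Lemma sum_ltS (f : nat -> nat) k d :
  \sum_(0 <= i < d.+1 | i < k.+1) f i =
  \sum_(0 <= i < d.+1 | i < k) f i + (if k <= d then f k else 0).
Proof.
rewrite (bigID (fun i => i == k)) /= addnC; congr (_ + _).
  by apply: eq_bigl => i; lia.
rewrite (eq_bigl (fun i => i == k)) ?big_nat1_eq ?ltnS // => i; lia.
Qed.

Section HeadCount.
Variables (n d : nat) (A L : pred (seq nat)).
Hypotheses (gr : growth_at n) (sA : stable A) (lL : lexset n.+1 d L).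

Let a k := cnt n (d - k) (fun l => A (k :: l)).
Let b k := cnt n (d - k) (fun l => L (k :: l)).
(** Each slice of [A] is replaced by the lex segment of its size. The growth bound in [n] variables
    keeps these segments compatible from one [k] to the next, as the slices of a stable set are. *)
Let C k := lexseg n (d - k) (a k).

Let cC k : cnt n (d - k) (C k) = a k.
Proof. by apply: cnt_lexseg; apply: cnt_le_size. Qed.

Let C_step j : j < d -> {in mons n (d - j), forall m, C j.+1 (red m) -> C j m}.
Proof.
move=> jd; have dj : d - j = (d - j.+1).+1 by lia.
apply: (@lexset_sub _ _ (fun m => C j.+1 (red m))).
- by rewrite dj; apply: lexset_red; apply: lexseg_lexset.
- exact: lexseg_lexset.
rewrite cC dj; apply: leq_trans (_ : cnt n (d - j.+1).+1 (fun m => A (j.+1 :: red m)) <= _).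
  apply: (gr (A := fun l => A (j.+1 :: l))); first exact: stable_tail.
    exact: lexseg_lexset.
  by rewrite cC.
rewrite /a -dj; apply: cnt_sub => m mm; apply: stable_red => //.
by rewrite (mons_sum mm); lia.
Qed.

Let C_iter k e s i : k + i <= d -> (e :: s) \in mons n (d - (k + i)) ->
  C (k + i) (e :: s) -> C k ((e + i) :: s).
Proof.
elim: i e => [|i IH] e; first by rewrite !addn0.
rewrite addnS => kd em Ce; rewrite -addSnnS; apply: IH; first lia.
  move: em; rewrite !mem_mons /= => /andP[-> /eqP E] /=; apply/eqP; lia.
apply: C_step => //; move: em; rewrite !mem_mons /= => /andP[-> /eqP E] /=; apply/eqP; lia.
Qed.

(** Some [u] in slice [k] of [L] misses [C k], hence lies below all of [C k]. An element [e :: s] of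
    [C j] lifts to [C k] by adding [j - k] to [e], so [s] beats the tail of [u]. This already puts
    [j :: e :: s] above [k :: u], hence in [L]. *)
Let tail_le k j : a k < b k -> k <= j <= d -> a j <= b j.
Proof.
move=> ab /andP[kj jd].
have lLk i : i <= d -> lexset n (d - i) (fun l => L (i :: l)) by move=> id; apply: lexset_tail.
case: (n =P 0) => [n0|n0].
  move: ab; rewrite /a /b n0 /cnt /=; case E: (d - k) => [|//] /=.
  by (have -> : j = k by lia); rewrite E /= => /ltnW.
have [u um /andP[Lu nCu]] : exists2 u, u \in mons n (d - k) & L (k :: u) && ~~ C k u.
  apply/hasP; apply/negPn/negP => /hasPn h; move: ab; rewrite ltnNge => /negP; apply.
  rewrite -(cC k); apply: cnt_sub => l lm Ll; have := h l lm; rewrite /= Ll /=.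
  by case: (C k l).
rewrite -(cC j); apply: cnt_sub => v vm Cv.
case: v vm Cv => [|e s] vm Cv; first by move: (mons_size vm) => /= E; rewrite -E in n0.
have jE : j = k + (j - k) by lia.
have em : (e + (j - k) :: s) \in mons n (d - k).
  by move: vm; rewrite !mem_mons /= => /andP[-> /eqP E] /=; apply/eqP; lia.
have Ce : C k (e + (j - k) :: s).
  by apply: C_iter; rewrite -jE.
have g : lgt (e + (j - k) :: s) u.
  have /or3P[/eqP E|//|g] : [|| e + (j - k) :: s == u,
      lgt (e + (j - k) :: s) u | lgt u (e + (j - k) :: s)].
  - exact: lgt_mons_total em um.
  - by rewrite -E Ce in nCu.
  - by move/negP: nCu; case; apply: (lexseg_lexset em um g Ce).
case: u um Lu nCu g => [//|f r] um Lu nCu g.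
rewrite (lgt_cons_mons em um) in g.
apply: (lL _ _ _ Lu); rewrite ?mons_cons //; [lia|]; last by rewrite /= g.
Qed.

(** Where slice [k] of [L] is the larger one, [tail_le] makes all later slices of [L] at least as
    large as those of [A], and the bound follows by subtraction from the totals. Elsewhere one adds
    the slice to the previous partial sum. *)
Lemma head_count k : cnt n.+1 d L <= cnt n.+1 d A ->
  \sum_(0 <= i < d.+1 | i < k) cnt n (d - i) (fun l => L (i :: l)) <=
  \sum_(0 <= i < d.+1 | i < k) cnt n (d - i) (fun l => A (i :: l)).
Proof.
rewrite !cntS -/a -/b => LA; elim: k => [|k IH]; first by rewrite !big_pred0.
case: (leqP k d) => kd; last first.
  by rewrite !sum_ltS (leqNgt k) kd !addn0.
case: (leqP (b k) (a k)) => [ba|ab].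
  by rewrite !sum_ltS kd leq_add.
have tl : \sum_(0 <= i < d.+1 | ~~ (i < k.+1)) a i <= \sum_(0 <= i < d.+1 | ~~ (i < k.+1)) b i.
  rewrite big_nat_cond [leqRHS]big_nat_cond; apply: leq_sum => i /andP[id ik].
  by apply: (tail_le ab); lia.
move: LA tl; rewrite (bigID (fun i => i < k.+1)) [X in _ <= X -> _](bigID (fun i => i < k.+1)) /=.
have arith x y z w : x + y <= z + w -> w <= y -> x <= z by lia.
exact: arith.
Qed.
End HeadCount.

Lemma cnt_head0 n d A (k := 1) :
  \sum_(0 <= i < d.+1 | i < k) cnt n (d - i) (fun l => A (i :: l)) =
  cnt n d (fun l => A (0 :: l)).
Proof.
rewrite big_ltn_cond //= subn0 big_nat_cond big_pred0 ?addn0 // => i.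
by rewrite /k; lia.
Qed.

(** In [cnt_redS] the second summand is bounded by hypothesis, and the first by induction, once
    [head_count] at 1 has compared the slices of head 0. *)
Lemma growth n : growth_at n.
Proof.
elim: n => [|n IH] d A L sA lL LA; first by rewrite /cnt.
have := @head_count n d A L IH sA lL 1 LA; rewrite !cnt_head0 => h0.
rewrite !cnt_redS leq_add //.
apply: (IH d (fun l => A (0 :: l)) (fun l => L (0 :: l))) => //; first exact: stable_tail.
by have := @lexset_tail n d 0 L (leq0n d) lL; rewrite subn0.
Qed.

(** * Lex segments against opposite lex segments *)

Fixpoint rgt (l l' : seq nat) : bool :=
  match l, l' with
  | a :: s, b :: s' => (b < a) || ((a == b) && rgt s s')
  | _, _ => false
  end.

(** [rgt] is the opposite lex order on exponent lists, and [R] stands for the complement of an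
    opposite lex segment. *)
Definition rdown n d (R : pred (seq nat)) :=
  forall l l', l \in mons n d -> l' \in mons n d -> rgt l l' -> R l -> R l'.

(** A proper [R] contains all slices with head below some [k] and misses all those above [k]. The
    full slices are compared by [head_count], and slice [k] by induction. *)
Lemma cnt_rdown n d A L R : stable A -> lexset n d L -> rdown n d R ->
  cnt n d L <= cnt n d A -> cnt n d (predI L R) <= cnt n d (predI A R).
Proof.
elim: n d A L R => [|n IH] d A L R sA lL dR LA.
  rewrite /cnt; case: d {lL dR} LA => //=; rewrite /cnt /=.
  by case: (L [::]); case: (A [::]); case: (R [::]).
have [full|/allPn[l0 l0m nR0]] := boolP (all R (mons n.+1 d)).
  have E B : cnt n.+1 d (predI B R) = cnt n.+1 d B.
    by apply: cnt_eq => l lm /=; rewrite (allP full) // andbT.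
  by rewrite !E.
pose bad k := (k <= d) && has (fun l => ~~ R (k :: l)) (mons n (d - k)).
have ex : exists k, bad k.
  have := mons_size l0m; case: l0 l0m nR0 => [//|k l0] l0m nR0 _; exists k.
  have kd : k <= d by have := mons_sum l0m; rewrite /=; lia.
  by rewrite /bad kd; apply/hasP; exists l0 => //; rewrite -mons_cons.
have [k /andP[kd /hasP[l1 l1m nR1]] kmin] := ex_minnP ex.
have Rlow i l : i < k -> l \in mons n (d - i) -> R (i :: l).
  move=> ik lm; apply/negPn/negP => nR; have : bad i.
    by rewrite /bad (ltnW (leq_trans ik kd)); apply/hasP; exists l.
  by move/kmin; lia.
have Rhigh i l : k < i -> i <= d -> l \in mons n (d - i) -> R (i :: l) = false.
  move=> ki id lm; apply/negP => Ri; move/negP: nR1; apply.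
  apply: (dR (i :: l)) => //; rewrite ?mons_cons //.
  by rewrite /= ki.
have E B : cnt n.+1 d (predI B R) =
   \sum_(0 <= i < d.+1 | i < k) cnt n (d - i) (fun l => B (i :: l)) +
   cnt n (d - k) (predI (fun l => B (k :: l)) (fun l => R (k :: l))).
  rewrite cntS (bigID (fun i => i < k)) /=; congr (_ + _).
    apply: eq_bigr => i ik; apply: cnt_eq => l lm /=.
    by rewrite Rlow ?andbT.
  rewrite (bigID (fun i => i == k)) /= (eq_bigl (fun i => i == k)) => [|i]; last lia.
  rewrite big_nat1_eq ltnS kd /= big_nat_cond big1 ?addn0 // => i /andP[id ik].
  rewrite /cnt (eq_in_count (a2 := pred0)) ?count_pred0 // => l lm /=.
  by rewrite Rhigh ?andbF //; lia.
rewrite !E.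
have hk := @head_count n d A L (@growth n) sA lL k LA.
have hk1 := @head_count n d A L (@growth n) sA lL k.+1 LA.
have dRk : rdown n (d - k) (fun l => R (k :: l)).
  move=> l l' lm l'm g; apply: dR; rewrite ?mons_cons //.
  by rewrite /= eqxx g orbT.
have lLk := lexset_tail kd lL.
have sAk := @stable_tail A k sA.
case: (leqP (cnt n (d - k) (fun l => L (k :: l))) (cnt n (d - k) (fun l => A (k :: l)))) => c.
  by apply: leq_add => //; apply: IH.
(* Slice [k] of [L] is too large for the induction hypothesis, which is applied to the lex segment
   of size [a] inside it. The surplus is paid for by [head_count] at [k.+1]. *)
set a := cnt n (d - k) (fun l => A (k :: l)) in c *.
have cC : cnt n (d - k) (lexseg n (d - k) a) = a by apply: cnt_lexseg; apply: cnt_le_size.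
have h1 := IH _ _ _ _ sAk (@lexseg_lexset n (d - k) a) dRk; rewrite cC in h1.
have {}h1 := h1 (leqnn _).
have CL : {in mons n (d - k), forall l, lexseg n (d - k) a l -> L (k :: l)}.
  by apply: lexset_sub => //; [exact: lexseg_lexset | rewrite cC ltnW].
have h2 : cnt n (d - k) (predI (lexseg n (d - k) a) (predC (fun l => R (k :: l)))) <=
   cnt n (d - k) (predI (fun l => L (k :: l)) (predC (fun l => R (k :: l)))).
  by apply: cnt_sub => l lm /andP[Cl Rl]; rewrite /= CL.
have h3 := cntIC n (d - k) (fun l => L (k :: l)) (fun l => R (k :: l)).
have h4 := cntIC n (d - k) (lexseg n (d - k) a) (fun l => R (k :: l)).
rewrite !sum_ltS kd -/a in hk1; rewrite cC in h4.
move: h1 h2 h3 h4 hk hk1.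
move: (cnt _ _ (predI (lexseg _ _ _) (fun l => R _))) (cnt _ _ (predI (lexseg _ _ _) (predC _))).
move: (cnt _ _ (predI (fun l => L _) (fun l => R _))) (cnt _ _ (predI (fun l => L _) (predC _))).
move: (cnt _ _ (predI (fun l => A _) (fun l => R _))) (cnt _ _ (fun l => L _)).
move: (\sum_(0 <= i < d.+1 | i < k) cnt n (d - i) (fun l => A _)) (bigop.body _ _ _).
lia.
Qed.

Lemma step_props l l' : step l l' -> [/\ size l' = size l, deg l' = deg l & lgt l' l].
Proof.
elim=> {l l'} [e f s|k s s' _ [E1 E2 g]] /=.
  by split=> //; [lia | rewrite eqxx ltnSn orbT].
by split; [congr S | congr addn | rewrite g].
Qed.

(** * Dickson's lemma and minimal growth in high degrees *)

(** The variable removed by [red] is never larger than the one just multiplied in. *)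
Lemma lge_red_incr l p : p < size l -> lge (red (incr_nth l p)) l.
Proof.
elim: l p => [//|a s IH] [|p] /= ps; first by rewrite /lge eqxx.
case: a => [|a]; last first.
  rewrite /lge /=; suff -> : lgt (incr_nth s p) s by rewrite orbT.
  elim: s p ps {IH} => [//|b s IH] [|p] /= ps; first by rewrite eqxx ltnSn orbT.
  by rewrite IH.
have /orP[/eqP->|g] := IH p ps; first by rewrite /lge eqxx.
by rewrite /lge /= g orbT.
Qed.

Lemma deg_incr l p : p < size l -> deg (incr_nth l p) = (deg l).+1.
Proof. by elim: l p => [//|a s IH] [|p] //= ps; rewrite IH // addnS. Qed.

Lemma all2_deg b l : all2 leq b l -> deg b <= deg l.
Proof. by elim: b l => [|x b IH] [|y l] //= /andP[xy /IH]; lia. Qed.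

Lemma all2_deg_eq b l : all2 leq b l -> deg l <= deg b -> b = l.
Proof.
elim: b l => [|x b IH] [|y l] //= /andP[xy bl] h; have := all2_deg bl => h'.
by rewrite (IH l bl); [congr cons; lia | lia].
Qed.

Lemma all2_incr b l : all2 leq b l -> deg b < deg l ->
  exists l' p, [/\ p < size l', l = incr_nth l' p & all2 leq b l'].
Proof.
elim: b l => [|x b IH] [|y l] //= /andP[xy bl] h.
case: (leqP y x) => yx; last first.
  exists (y.-1 :: l), 0; split => //=; last by rewrite bl andbT; lia.
  by rewrite prednK //; lia.
have [l' [p [ps E h']]] := IH l bl ltac:(lia).
by exists (y :: l'), p.+1; split => //=; rewrite ?E // xy.
Qed.

(** Induction on the length. A finite basis of the tails lifts to [P] with heads at most [N]; the
    lifts cover all lists of head at least [N], and each of the finitely many slices of smaller head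
    has a basis of its own. *)
Lemma dickson n (P : seq nat -> Prop) : (forall l, P l -> size l = n) ->
  exists s : seq (seq nat), (forall b, b \in s -> P b) /\
    (forall l, P l -> exists2 b, b \in s & all2 leq b l).
Proof.
elim: n P => [|n IH] P Pn.
  have [P0|nP0] := classic (P [::]).
    exists [:: [::]]; split => [b|[|a l] Pl]; first by rewrite inE => /eqP->.
      by exists [::].
    by have := Pn _ Pl.
  by exists [::]; split => // -[|a l] Pl //; have := Pn _ Pl.
have [|s [sP sQ]] := IH (fun l => exists k, P (k :: l)); first by move=> l [k /Pn []].
have [t [N [tP tQ]]] : exists (t : seq (seq nat)) N, (forall b, b \in t -> P b) /\
    (forall b, b \in s -> exists2 k, k <= N & k :: b \in t).
  elim: s sP {sQ} => [|b s IHs] sP; first by exists [::], 0.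
  have [|t [N [tP tQ]]] := IHs; first by move=> x xs; apply: sP; rewrite inE xs orbT.
  have [k Pk] := sP b (mem_head _ _).
  exists ((k :: b) :: t), (maxn k N); split=> x; rewrite inE => /orP[/eqP->|xs] //.
  - exact: tP.
  - by exists k; rewrite ?leq_maxl ?mem_head.
  - by have [j jN jt] := tQ x xs; exists j; rewrite ?inE ?jt ?orbT // leq_max jN orbT.
have [u [uP uQ]] : exists u : seq (seq nat), (forall b, b \in u -> P b) /\
    (forall k l, k < N -> P (k :: l) -> exists2 b, b \in u & all2 leq b (k :: l)).
  elim: N {tQ} => [|N [u [uP uQ]]]; first by exists [::].
  have [|v [vP vQ]] := IH (fun l => P (N :: l)); first by move=> l /Pn [].
  exists (u ++ [seq N :: b | b <- v]); split=> [b|k l].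
    by rewrite mem_cat => /orP[/uP//|/mapP[c /vP Pc ->]].
  rewrite ltnS leq_eqVlt => /orP[/eqP-> Pl|kN Pl].
    have [b bv bl] := vQ _ Pl; exists (N :: b); last by rewrite /= leqnn.
    by rewrite mem_cat map_f ?orbT.
  by have [b bu bl] := uQ _ _ kN Pl; exists b; rewrite ?mem_cat ?bu.
exists (t ++ u); split=> [b|l Pl]; first by rewrite mem_cat => /orP[/tP|/uP].
case: l Pl (Pn _ Pl) => [//|k l] Pl _.
case: (ltnP k N) => kN.
  by have [b bu bl] := uQ _ _ kN Pl; exists b; rewrite ?mem_cat ?bu ?orbT.
have [|b bs bl] := sQ l; first by exists k.
have [j jN jt] := tQ b bs; exists (j :: b); rewrite ?mem_cat ?jt //=.
by rewrite (leq_trans jN kN).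
Qed.

(** Together the segments are closed under multiplication by variables, so they have finitely many
    generators. Beyond their largest degree, a member of degree [d.+1] is a variable times a member
    [l'] of degree [d]; its reduction is at least [l'], hence again in the segment. *)
Lemma lexseg_eventually n (c : nat -> nat) :
  (forall d, c d <= size (mons n d)) ->
  (forall d, cnt n d.+1 (fun l => lexseg n d (c d) (red l)) <= c d.+1) ->
  exists D, forall d, D <= d ->
    c d.+1 = cnt n d.+1 (fun l => lexseg n d (c d) (red l)).
Proof.
move=> cN cS; pose T d := lexseg n d (c d).
have Tmons d l : T d l -> l \in mons n d.
  by rewrite /T /lexseg => /mem_take; rewrite mem_sort.
have lT d : lexset n d (T d) by exact: lexseg_lexset.
have TS d : {in mons n d.+1, forall l, T d (red l) -> T d.+1 l}.
  apply: (@lexset_sub _ _ (fun l => T d (red l))) => //; first exact: lexset_red.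
  by rewrite [leqRHS]cnt_lexseg.
have Tincr d l p : T d l -> p < size l -> T d (red (incr_nth l p)) /\ T d.+1 (incr_nth l p).
  move=> Tl pl; have lm := Tmons _ _ Tl.
  have im : incr_nth l p \in mons n d.+1.
    by move: lm; rewrite !mem_mons size_incr_nth pl deg_incr // eqSS.
  have Tr : T d (red (incr_nth l p)).
    case/orP: (lge_red_incr pl) => [/eqP->//|g].
    by apply: (lT d l) => //; apply: red_mons.
  by split=> //; apply: TS.
have [s [sT sQ]] := @dickson n (fun l => T (deg l) l) (fun l Tl => mons_size (Tmons _ _ Tl)).
have Tdiv b l : T (deg b) b -> all2 leq b l -> T (deg l) l.
  move=> Tb; move E: (deg l) => e; elim: e l E => [|e IHe] l E bl.
    by rewrite -E; rewrite -(all2_deg_eq bl) // E.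
  case: (ltnP (deg b) (deg l)) => [bl'|lb]; last by rewrite -E -(all2_deg_eq bl lb).
  have [l' [p [ps El h']]] := all2_incr bl bl'.
  have dl' : deg l' = e by move: E; rewrite El deg_incr // => -[].
  by rewrite El; apply: (Tincr _ _ _ _ ps).2; apply: IHe.
exists (\max_(b <- s) deg b) => d Dd; apply/eqP; rewrite eqn_leq cS andbT.
rewrite -[leqLHS](cnt_lexseg (cN d.+1)); apply: cnt_sub => l lm Tl.
have dl := mons_sum lm.
have [|b bs bl] := sQ l; first by rewrite dl.
have bd : deg b <= d by apply: leq_trans Dd; rewrite (leq_bigmax_seq b).
have [l' [p [ps El h']]] := all2_incr bl ltac:(lia).
have dl' : deg l' = d by move: dl; rewrite El deg_incr // => -[].
by rewrite El; apply: (Tincr _ _ _ _ ps).1; rewrite -dl'; apply: Tdiv h'; apply: sT.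
Qed.

Local Open Scope ring_scope.

(** * Forms of degree d as row vectors *)

Definition lst n (m : 'X_{1..n}) : seq nat := rev m.
Definition mlst n (l : seq nat) : 'X_{1..n} := [multinom nth 0%N (rev l) j | j < n].

Lemma size_lst n (m : 'X_{1..n}) : size (lst m) = n.
Proof. by rewrite size_rev size_tuple. Qed.

Lemma lstK n (m : 'X_{1..n}) : mlst n (lst m) = m.
Proof. by apply/mnmP => i; rewrite mnmE revK -mnm_nth. Qed.

Lemma nth_mlst n l (i : 'I_n) : mlst n l i = nth 0%N (rev l) i.
Proof. exact: mnmE. Qed.

Lemma mlstK n l : size l = n -> lst (mlst n l) = l.
Proof.
move=> sl; rewrite /lst -[RHS]revK; congr rev.
apply: (@eq_from_nth _ 0%N); rewrite size_tuple ?size_rev // => i ilt.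
by rewrite -(mnm_nth 0%N _ (Ordinal ilt)) nth_mlst.
Qed.

Lemma deg_sum l : deg l = sumn l.
Proof. by elim: l => //= a s ->. Qed.

Lemma deg_lst n (m : 'X_{1..n}) : deg (lst m) = mdeg m.
Proof. by rewrite deg_sum sumn_rev sumnE /mdeg. Qed.

Lemma lst_mons n (m : 'X_{1..n}) : lst m \in mons n (mdeg m).
Proof. by rewrite mem_mons size_lst deg_lst !eqxx. Qed.

Section Mon.
Variables (n d : nat).
Local Notation N := (size (mons n d)).

Definition lsti (i : 'I_N) : seq nat := nth [::] (mons n d) i.
Definition mon (i : 'I_N) : 'X_{1..n} := mlst n (lsti i).

Lemma lsti_mons i : lsti i \in mons n d.
Proof. exact: mem_nth. Qed.

Lemma lst_mon i : lst (mon i) = lsti i.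
Proof. by rewrite mlstK // (mons_size (lsti_mons i)). Qed.

Lemma lsti_inj : injective lsti.
Proof.
move=> i j /eqP; rewrite nth_uniq ?mons_uniq // => /eqP; exact: val_inj.
Qed.

Lemma mon_inj : injective mon.
Proof. by move=> i j E; apply: lsti_inj; rewrite -!lst_mon E. Qed.

Lemma mdeg_mon i : mdeg (mon i) = d.
Proof. by rewrite -deg_lst lst_mon (mons_sum (lsti_mons i)). Qed.

Lemma lsti_surj l : l \in mons n d -> exists i, lsti i = l.
Proof.
move=> lm; have il : (index l (mons n d) < N)%N by rewrite index_mem.
by exists (Ordinal il); rewrite /lsti nth_index.
Qed.

Lemma mon_surj m : mdeg m = d -> exists i, mon i = m.
Proof.
move=> md; have [|i il] := @lsti_surj (lst m); first by rewrite -md lst_mons.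
by exists i; rewrite /mon il lstK.
Qed.

Lemma cnt_card (A : pred (seq nat)) : cnt n d A = #|[set i : 'I_N | A (lsti i)]|.
Proof.
rewrite /cnt -sum1_count (big_nth [::]) big_mkord -sum1dep_card.
by apply: eq_bigl.
Qed.

Section Coef.
Variable R : comNzRingType.
Local Notation S := {mpoly R[n]}.

Definition pol (v : 'rV[R]_N) : S := \sum_i v 0 i *: 'X_[mon i].
Definition cf (p : S) : 'rV[R]_N := \row_i p@_(mon i).

Lemma pol_is_linear : linear pol.
Proof.
move=> a u v; rewrite /pol scaler_sumr -big_split /=; apply: eq_bigr => i _.
by rewrite !mxE scalerDl scalerA.
Qed.
HB.instance Definition _ := GRing.isLinear.Build R 'rV[R]_N S *:%R pol pol_is_linear.

Lemma cf_is_linear : linear cf.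
Proof. by move=> a p q; apply/rowP => i; rewrite !mxE mcoeffD mcoeffZ. Qed.
HB.instance Definition _ := GRing.isLinear.Build R S 'rV[R]_N *:%R cf cf_is_linear.

Lemma mcoeff_pol v i : (pol v)@_(mon i) = v 0 i.
Proof.
rewrite /pol raddf_sum (bigD1 i) //= mcoeffZ mcoeffX eqxx mulr1 big1 ?addr0 // => j ji.
by rewrite mcoeffZ mcoeffX (inj_eq mon_inj) (negPf ji) mulr0.
Qed.

Lemma polK : cancel pol cf.
Proof. by move=> v; apply/rowP => i; rewrite mxE mcoeff_pol. Qed.

Lemma pol_homog v : pol v \is d.-homog.
Proof. by apply: rpred_sum => i _; apply: rpredZ; rewrite dhomogX; apply/eqP/mdeg_mon. Qed.

Lemma cfK p : p \is d.-homog -> pol (cf p) = p.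
Proof.
move=> hp; apply/mpolyP => m; case: (eqVneq (mdeg m) d) => [md|md].
  by have [i <-] := mon_surj md; rewrite mcoeff_pol mxE.
by rewrite (dhomog_nemf_coeff hp) // (dhomog_nemf_coeff (pol_homog _)).
Qed.

Lemma cfX i : cf 'X_[mon i] = delta_mx 0 i.
Proof. by apply/rowP => j; rewrite !mxE mcoeffX (inj_eq mon_inj) eq_sym eqxx. Qed.
End Coef.
End Mon.

Lemma mpoly_linear_ext n (R : comNzRingType) (V : lmodType R) (f g : {linear {mpoly R[n]} -> V}) p :
  (forall m, f 'X_[m] = g 'X_[m]) -> f p = g p.
Proof.
move=> fg; rewrite [p]mpolyE (linear_sum f) (linear_sum g); apply: eq_bigr => m _.
by rewrite !linearZ fg.
Qed.

Section Change.
Variables (n : nat).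

(** This is [coord_change] over any ring: [{poly K}] serves for one-parameter families, [{mpoly
    K[n * n]}] for the generic matrix. *)
Definition chg (R : comNzRingType) (h : 'M[R]_n) (p : {mpoly R[n]}) : {mpoly R[n]} :=
  p \mPo [tuple \sum_(j < n) h j i *: 'X_j | i < n].

Section R.
Variable R : comNzRingType.
Implicit Types (h : 'M[R]_n) (p q : {mpoly R[n]}).

HB.instance Definition _ h := GRing.RMorphism.copy (chg h)
   (comp_mpoly [tuple \sum_(j < n) h j i *: 'X_j | i < n]).
HB.instance Definition _ h := GRing.Linear.copy (chg h)
   (comp_mpoly [tuple \sum_(j < n) h j i *: 'X_j | i < n]).

Lemma chgX h m : chg h 'X_[m] = \prod_(i < n) (\sum_(j < n) h j i *: 'X_j) ^+ m i.
Proof. by rewrite /chg comp_mpolyX; apply: eq_bigr => i _; rewrite tnth_mktuple. Qed.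

Lemma chgXU h i : chg h 'X_i = \sum_(j < n) h j i *: 'X_j.
Proof. by rewrite /chg comp_mpolyXU -tnth_nth tnth_mktuple. Qed.

Lemma chg_homog d h p : p \is d.-homog -> chg h p \is d.-homog.
Proof.
move=> /dhomogP hp; rewrite [p]mpolyE raddf_sum /= big_seq; apply: rpred_sum => m /hp md.
rewrite linearZ /=; apply: rpredZ; rewrite chgX.
have <- : (\sum_i m i)%N = d by rewrite -mdegE.
elim/big_ind2: _ => [|x a y b hx hy|i _]; first exact: dhomog1.
  exact: dhomogM.
suff /(dhomogMn (m i)) : \sum_(j < n) h j i *: 'X_j \is 1.-homog by rewrite mul1n.
by apply: rpred_sum => j _; apply: rpredZ; rewrite dhomogX; apply/eqP/mdeg1.
Qed.

Lemma chgM h1 h2 p : chg (h1 *m h2) p = chg h1 (chg h2 p).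
Proof.
apply: (mpoly_linear_ext (f := chg _) (g := chg h1 \o chg h2)) => m /=.
rewrite !chgX (rmorph_prod (chg h1)); apply: eq_bigr => i _; rewrite rmorphXn; congr (_ ^+ _).
rewrite raddf_sum /=; under [RHS]eq_bigr => j _ do rewrite linearZ /= chgXU scaler_sumr.
rewrite exchange_big /=; apply: eq_bigr => k _; rewrite mxE scaler_suml.
by apply: eq_bigr => j _; rewrite scalerA mulrC.
Qed.

Lemma chg1 p : chg 1%:M p = p.
Proof.
rewrite -[RHS]comp_mpoly_id /chg; congr comp_mpoly; apply/eq_from_tnth => i.
rewrite !tnth_mktuple (bigD1 i) //= mxE eqxx scale1r big1 ?addr0 // => j ji.
by rewrite mxE (negPf ji) scale0r.
Qed.
End R.

End Change.

HB.lock Definition rho (n d : nat) (R : comNzRingType) (h : 'M[R]_n) : 'M[R]_(size (mons n d)) :=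
  \matrix_(i, j) (chg h 'X_[mon i])@_(mon j).
Canonical rho_unlockable := Unlockable rho.unlock.
Arguments rho {n} d {R} h.

Section Rho.
Variable n : nat.
Variable d : nat.
Local Notation N := (size (mons n d)).

Lemma rhoE (R : comNzRingType) (h : 'M[R]_n) i j :
  rho d h i j = (chg h 'X_[mon i])@_(mon j).
Proof. by rewrite unlock mxE. Qed.

Lemma cf_chg (R : comNzRingType) (h : 'M[R]_n) p : p \is d.-homog ->
  cf d (chg h p) = cf d p *m rho d h.
Proof.
move=> hp; rewrite -{1}(cfK hp) /pol (linear_sum (chg h)) (linear_sum (@cf n d R)) mulmx_sum_row /=.
apply: eq_bigr => i _; rewrite !linearZ /=; congr (_ *: _).
by apply/rowP => j; rewrite !mxE rhoE.
Qed.

(** Forms are row vectors with matrices acting on the right, hence the reversed product. *)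
Lemma rhoM (R : comNzRingType) (h1 h2 : 'M[R]_n) : rho d (h1 *m h2) = rho d h2 *m rho d h1.
Proof.
apply/row_matrixP => i; rewrite row_mul.
have E h : row i (rho d h) = cf d (chg h 'X_[mon i]) by apply/rowP => j; rewrite !mxE rhoE.
rewrite !E chgM cf_chg //; apply: chg_homog; rewrite dhomogX; exact/eqP/mdeg_mon.
Qed.

Lemma rho1 (R : comNzRingType) : rho d (1%:M : 'M[R]_n) = 1%:M.
Proof. by apply/matrixP => i j; rewrite rhoE mxE chg1 mcoeffX (inj_eq (@mon_inj n d)). Qed.

Lemma rho_map (R R' : comNzRingType) (f : {rmorphism R -> R'}) (h : 'M[R]_n) :
  map_mx f (rho d h) = rho d (map_mx f h).
Proof.
apply/matrixP => i j; rewrite mxE !rhoE -mcoeff_map_mpoly !chgX rmorph_prod.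
congr (mcoeff _ _); apply: eq_bigr => k _; rewrite rmorphXn; congr (_ ^+ _).
rewrite (raddf_sum (map_mpoly f)); apply: eq_bigr => l _.
by rewrite /= map_mpolyZ map_mpolyX mxE.
Qed.

Lemma rho_diag (R : comNzRingType) (a : 'rV[R]_n) :
  rho d (diag_mx a) = diag_mx (\row_i \prod_k a 0 k ^+ mon i k).
Proof.
apply/matrixP => i j; rewrite rhoE !mxE chgX.
have E k : \sum_(j < n) diag_mx a j k *: 'X_j = a 0 k *: 'X_k :> {mpoly R[n]}.
  rewrite (bigD1 k) //= mxE eqxx mulr1n big1 ?addr0 // => l lk.
  by rewrite mxE (negPf lk) mulr0n scale0r.
rewrite (eq_bigr (fun k => a 0 k ^+ mon i k *: 'X_k ^+ mon i k));
  last by move=> k _; rewrite E exprZn.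
rewrite scaler_prod -mpolyXE_id mcoeffZ mcoeffX (inj_eq (@mon_inj n d)).
by rewrite mulr_natr.
Qed.
End Rho.

Section MulX.
Variables (n d : nat) (R : comNzRingType).

Definition mulX (k : 'I_n) : 'M[R]_(size (mons n d), size (mons n d.+1)) :=
  \matrix_(i, j) (mon j == (mon i + U_(k))%MM)%:R.

Lemma cf_mulX k p : p \is d.-homog -> cf d.+1 ('X_k * p) = cf d p *m mulX k.
Proof.
move=> hp; rewrite -{1}(cfK hp) /pol mulr_sumr linear_sum mulmx_sum_row /=.
apply: eq_bigr => i _; rewrite -scalerAr !linearZ /=; congr (_ *: _).
by apply/rowP => j; rewrite !mxE -mpolyXD mcoeffX addmC eq_sym.
Qed.
End MulX.

(** * Semicontinuity of the rank and reduced row bases *)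

(** The constant matrices [P] and [Q] turn [M0] into an identity matrix of size its rank. The
    determinant [a] of [P M Q] lives in [R], and the rank cannot drop where it does not vanish. *)
Lemma rank_open (K : fieldType) (R : comNzRingType) (c : {rmorphism K -> R}) p q
    (M : 'M[R]_(p, q)) (f0 : {rmorphism R -> K}) (f0c : cancel c f0) :
  exists2 a, f0 a != 0 & forall f : {rmorphism R -> K}, cancel c f -> f a != 0 ->
    (\rank (map_mx f0 M) <= \rank (map_mx f M))%N.
Proof.
set M0 := map_mx f0 M.
pose P := pinvmx (col_base M0); pose Q := pinvmx (row_base M0).
have PQ : P *m M0 *m Q = 1%:M.
  have : P *m (col_base M0 *m row_base M0) *m Q = 1%:M.
    by rewrite (mulmxA P) (mulVpmx (col_base_full _)) mul1mx mulmxVp // row_base_free.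
  by rewrite mulmx_base.
pose a := \det (map_mx c P *m M *m map_mx c Q).
have fa (f : {rmorphism R -> K}) : cancel c f -> f a = \det (P *m map_mx f M *m Q).
  by move=> fc; rewrite -det_map_mx !map_mxM /= -!map_mx_comp !(map_mx_id (f := f \o c)).
exists a => [|f fc]; first by rewrite fa // PQ det1 oner_neq0.
rewrite fa // -unitfE -[_ \is a _]/(_ \in unitmx) => /mxrank_unit E.
by rewrite -[leqLHS]E (leq_trans (mxrankM_maxl _ _)) ?mxrankM_maxr.
Qed.

Section Rank.
Variable K : fieldType.
Hypothesis charK0 : [pchar K] =i pred0.

(** In characteristic 0 the integers from 1 to [size p] are distinct and nonzero in [K], and there
    are more of them than roots. *)
Lemma poly_nonroot (p : {poly K}) : p != 0 -> exists2 t, t != 0 & p.[t] != 0.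
Proof.
move=> p0; pose s : seq K := [seq i.+1%:R | i <- iota 0 (size p)].
have us : uniq s.
  rewrite map_inj_uniq ?iota_uniq // => i j; wlog ij : i j / (i <= j)%N => [H E|].
    by case: (leqP i j) => [|/ltnW] ij; [apply: H | symmetry; apply: H].
  move=> /esym/eqP; rewrite -subr_eq0 -natrB //; have /pcharf0P -> := charK0; lia.
have [/allP h|/allPn[t ts nt]] := boolP (all (root p) s).
  have := max_poly_roots p0 (introT allP h) us.
  by rewrite size_map size_iota ltnn.
exists t => //; case/mapP: ts => i _ ->.
by have /pcharf0P -> := charK0.
Qed.

Definition ev (t : K) p q (M : 'M[{poly K}]_(p, q)) := map_mx (horner_eval t) M.

Lemma poly_rank p q (M : 'M[{poly K}]_(p, q)) :
  exists2 t, t != 0 & (\rank (ev 0 M) <= \rank (ev t M))%N.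
Proof.
have evC t : cancel (@polyC K) (horner_eval t) by move=> x; rewrite /horner_eval hornerC.
have [a a0 aP] := rank_open (c := polyC) M (f0 := horner_eval 0) (evC 0).
have [|t t0 ta] := @poly_nonroot a; last by exists t => //; apply: (aP (horner_eval t) (evC t) ta).
by apply: contraNneq a0 => ->; rewrite rmorph0.
Qed.
End Rank.

Section Dset.
Variables (K : fieldType) (N : nat).
Implicit Types A B : {set 'I_N}.

Definition dset A : 'M[K]_N := diag_mx (\row_i (i \in A)%:R).

Lemma dsetE A i j : dset A i j = ((i == j) && (i \in A))%:R.
Proof. by rewrite !mxE; case: eqP; rewrite ?mulr1n ?mulr0n // => ->. Qed.

Lemma mul_dset m A (M : 'M[K]_(N, m)) i j : (dset A *m M) i j = (i \in A)%:R * M i j.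
Proof. by rewrite mul_diag_mx !mxE. Qed.

Lemma mul_mx_dset m A (M : 'M[K]_(m, N)) i j : (M *m dset A) i j = M i j * (j \in A)%:R.
Proof. by rewrite mul_mx_diag !mxE. Qed.

Lemma dsetI A B : dset A *m dset B = dset (A :&: B).
Proof.
apply/matrixP => i j; rewrite mul_dset !dsetE inE -natrM mulnb.
by rewrite andbCA.
Qed.

Lemma rank_dset A : \rank (dset A) = #|A|.
Proof.
have le B : (\rank (dset B) <= #|B|)%N.
  pose M1 : 'M[K]_(N, #|B|) := \matrix_(i, k) (i == enum_val k)%:R.
  suff -> : dset B = M1 *m M1^T by rewrite (leq_trans (mxrankM_maxl _ _)) ?rank_leq_col.
  apply/matrixP => i j; rewrite dsetE mxE.
  have [iB|iB] := boolP (i \in B); last first.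
    rewrite andbF big1 // => k _; rewrite !mxE; case: eqP => [E|_]; last by rewrite mul0r.
    by rewrite E enum_valP in iB.
  rewrite (bigD1 (enum_rank_in iB i)) //= !mxE enum_rankK_in // eqxx mul1r andbT.
  rewrite big1 ?addr0 1?eq_sym // => k ki; rewrite !mxE; case: eqP => [E|_]; last by rewrite mul0r.
  by case/eqP: ki; apply: enum_val_inj; rewrite enum_rankK_in.
(* The upper bounds for [A] and its complement add up to [N], the rank of the identity, so both are
   equalities. *)
have E : dset A + dset (~: A) = 1%:M.
  apply/matrixP => i j; rewrite mxE !dsetE mxE inE; case: eqP => //= _; last by rewrite addr0.
  by case: (i \in A); rewrite ?addr0 ?add0r.
have := mxrank_add (dset A) (dset (~: A)); rewrite E mxrank1.
have := le A; have := le (~: A); have := cardsC A; rewrite card_ord.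
lia.
Qed.

Lemma dsetS A B : A \subset B -> (dset A <= dset B)%MS.
Proof. by move=> /setIidPl <-; rewrite -dsetI submxMl. Qed.

Lemma dset_addsmx A B : (dset A + dset B :=: dset (A :|: B))%MS.
Proof.
apply/eqmxP/andP; split; first by rewrite addsmx_sub !dsetS ?subsetUl ?subsetUr.
have -> : dset (A :|: B) = dset A + dset (B :\: A).
  apply/matrixP => i j; rewrite [RHS]mxE !dsetE !inE; case: eqP => _ /=; last by rewrite addr0.
  by case: (i \in A); case: (i \in B); rewrite ?addr0 ?add0r.
apply: addmx_sub_adds => //; apply: dsetS; exact: subsetDl.
Qed.

Lemma rank_dset_cap A B : \rank (dset A :&: dset B)%MS = #|A :&: B|.
Proof.
have := mxrank_sum_cap (dset A) (dset B).
by rewrite dset_addsmx !rank_dset -cardsUI => /addnI.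
Qed.

Lemma sub_dsetP m (M : 'M[K]_(m, N)) A :
  reflect (forall i j, M i j != 0 -> j \in A) (M <= dset A)%MS.
Proof.
apply: (iffP idP) => [/submxP[D ->] i j|h].
  by rewrite mul_mx_dset; case: (j \in A); rewrite ?mulr0 ?eqxx.
suff -> : M = M *m dset A by apply: submxMl.
apply/matrixP => i j; rewrite mul_mx_dset; have := h i j.
by case: (eqVneq (M i j) 0) => [->|_ ->//]; rewrite ?mul0r // mulr1.
Qed.

Section Echelon.
Variable w : 'I_N -> nat.
Hypothesis winj : injective w.

(** Leading positions have the smallest weight, so that they survive when the parameter of a
    degeneration tends to 0. *)
Definition leads (V : 'M[K]_N) (i : 'I_N) (v : 'rV[K]_N) :=
  [/\ (v <= V)%MS, v 0 i = 1 & forall j, v 0 j != 0 -> j != i -> (w i < w j)%N].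

(** Row [i] is reserved for the leading position [i], which lets the limit be [dset A] itself.
    Entries at the other leading positions are not cleared. *)
Definition reduced (A : {set 'I_N}) (E : 'M[K]_N) :=
  [/\ forall i j, i \notin A -> E i j = 0, forall i, i \in A -> E i i = 1
    & forall i j, E i j != 0 -> j != i -> (w i < w j)%N].

Lemma echelon V : exists A E,
  [/\ (E :=: V)%MS, reduced A E & forall i, i \in A <-> exists v, leads V i v].
Proof.
pose A := [set i | if excluded_middle_informative (exists v, leads V i v) then true else false].
have AP i : i \in A <-> exists v, leads V i v.
  by rewrite inE; case: excluded_middle_informative.
have [e eP] : exists e : 'I_N -> 'rV[K]_N, forall i, if i \in A then leads V i (e i) else e i = 0.
  apply: (@fin_all_exists _ (fun=> 'rV[K]_N) (fun i v =>
    if i \in A then leads V i v else v = 0)) => i.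
  by case: (boolP (i \in A)) => [/AP //|_]; exists 0.
pose E : 'M[K]_N := \matrix_(i, j) e i 0 j.
have rowE i : row i E = e i by apply/rowP => j; rewrite !mxE.
exists A, E; split=> //.
- apply/eqmxP/andP; split.
    apply/row_subP => i; rewrite rowE; have := eP i; case: ifP => [_ []//|_ ->].
    exact: sub0mx.
  apply/row_subP => r; pose Mx := \max_i w i.
  (* Induction on the room left above the lowest possible weight: subtracting a multiple of [e i]
     clears that weight, and no weight exceeds [Mx]. *)
  have key k (v : 'rV[K]_N) : (v <= V)%MS ->
      (forall j, v 0 j != 0 -> (Mx.+1 - k <= w j)%N) -> (v <= E)%MS.
    elim: k v => [|k IH] v vV vs.
      suff -> : v = 0 by apply: sub0mx.
      apply/rowP => j; rewrite mxE; apply/eqP/negPn/negP => /vs.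
      by have := leq_bigmax (F := w) j; rewrite -/Mx; lia.
    have [[i [wi vi]]|no] := classic (exists i, w i = (Mx.+1 - k.+1)%N /\ v 0 i != 0).
      have iA : i \in A.
        apply/AP; exists ((v 0 i)^-1 *: v); split; first exact: scalemx_sub.
          by rewrite mxE mulVf.
        move=> j; rewrite mxE mulf_eq0 negb_or => /andP[_ /vs h] ji.
        by have := (inj_eq winj j i); rewrite (negPf ji); lia.
      have := eP i; rewrite iA => -[eV ei es].
      rewrite -[v](subrK (v 0 i *: e i)); apply: addmx_sub; last first.
        by apply: scalemx_sub; rewrite -rowE row_sub.
      apply: IH => [|j]; first by rewrite addmx_sub // -scaleNr scalemx_sub.
      rewrite !mxE; case: (eqVneq j i) => [->|ji]; first by rewrite ei mulr1 subrr eqxx.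
      have wji : w j != w i by rewrite (inj_eq winj).
      case: (eqVneq (e i 0 j) 0) => [->|/es/(_ ji) h _]; last by lia.
      by rewrite mulr0 subr0 => /vs; lia.
    apply: IH => // j vj; have := vs j vj; rewrite leq_eqVlt => /orP[/eqP wj|]; last lia.
    by case: no; exists j.
  apply: (key Mx.+1); first exact: row_sub.
  by move=> j _; rewrite subnn.
- split=> [i j iA|i iA|i j]; rewrite ?mxE.
  + by have := eP i; rewrite (negPf iA) => ->; rewrite mxE.
  + by have := eP i; rewrite iA => -[].
  + by have := eP i; case: ifP => _ [] // => [_ _ h|->]; [apply: h | rewrite mxE eqxx].
Qed.

Lemma reduced_mul A E : reduced A E -> dset A *m E = E.
Proof.
move=> [E0 _ _]; apply/matrixP => i j; rewrite mul_dset.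
by case: (boolP (i \in A)) => [_|/E0->]; rewrite ?mul1r ?mulr0.
Qed.

Definition below s A := [set i in A | w i <= s]%N.

(** On positions of weight at most [s], only the rows of [E] with leading position in [below s A]
    are nonzero, while by hypothesis [E] projects onto all of the coordinates in [A1]. *)
Lemma reduced_dominates A E A1 s : reduced A E -> (#|A1| <= \rank (E *m dset A1))%N ->
  (#|below s A1| <= #|below s A|)%N.
Proof.
move=> red h; have [E0 _ Ew] := red.
have sub : (dset A1 <= E *m dset A1)%MS.
  have := mxrank_leqif_sup (submxMl E (dset A1)); rewrite rank_dset => /geq_leqif <-.
  exact: h.
pose L := [set i | w i <= s]%N.
have bE B : below s B = B :&: L by apply/setP => i; rewrite !inE.
have := mxrankS (submxMr (dset L) sub); rewrite -mulmxA !dsetI rank_dset -!bE => h1.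
apply: leq_trans h1 _.
suff -> : E *m dset (below s A1) = dset (below s A) *m (E *m dset (below s A1)).
  by rewrite (leq_trans (mxrankM_maxl _ _)) ?rank_dset.
apply/matrixP => i j; rewrite mul_dset !mul_mx_dset !inE.
have [iA|iA] := boolP (i \in A); last by rewrite E0 // !(mul0r, mulr0).
case: (leqP (w i) s) => wi /=; first by rewrite mul1r.
rewrite mul0r; case: (eqVneq (E i j) 0) => [->|/Ew h2]; first by rewrite mul0r.
case: (leqP (w j) s) => wj; last by rewrite andbF mulr0.
have ji : j != i by apply: contraTneq wj => ->; rewrite -ltnNge.
by have := h2 ji; lia.
Qed.
End Echelon.
End Dset.

(** * Degenerations *)

Lemma map_mxcol (T U : Type) (f : T -> U) q m (p_ : 'I_q -> nat)
    (B : forall i, 'M[T]_(p_ i, m)) :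
  map_mx f (\mxcol_i B i) = \mxcol_i map_mx f (B i).
Proof. by apply/matrixP => i j; rewrite !mxE. Qed.

Section Degen.
Variables (K : fieldType) (n : nat).
Hypothesis charK0 : [pchar K] =i pred0.

Lemma rho_inv d (h : 'M[K]_n) : h \in unitmx -> rho d h *m rho d (invmx h) = 1%:M.
Proof. by move=> hu; rewrite -rhoM mulVmx // rho1. Qed.

Lemma rho_unit d (h : 'M[K]_n) : h \in unitmx -> rho d h \in unitmx.
Proof. move=> hu; exact: (mulmx1_unit (rho_inv d hu)).1. Qed.

Lemma evC t p q (A : 'M[K]_(p, q)) : ev t (map_mx polyC A) = A.
Proof. by apply/matrixP => i j; rewrite !mxE /horner_eval hornerC. Qed.

(** Over a field, the row space is the product of [V] with the linear forms. *)
Definition mulm (R : comNzRingType) d (V : 'M[R]_(size (mons n d))) :=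
  \mxcol_(k < n) (V *m mulX d R k).

Lemma ev_mulm t d (V : 'M[{poly K}]_(size (mons n d))) : ev t (mulm V) = mulm (ev t V).
Proof.
rewrite /mulm /ev map_mxcol; apply/eq_mxcol => k.
rewrite map_mxM /=; congr (_ *m _).
by apply/matrixP => i j; rewrite !mxE rmorph_nat.
Qed.

Lemma mulmE d (V : 'M[K]_(size (mons n d))) :
  (mulm V :=: \sum_(k < n) <<V *m mulX d K k>>)%MS.
Proof. exact: eqmx_col. Qed.

Lemma mulm_subP d (V : 'M[K]_(size (mons n d))) q (W : 'M[K]_(q, size (mons n d.+1))) :
  (forall k, (V *m mulX d K k <= W)%MS) -> (mulm V <= W)%MS.
Proof. by move=> h; rewrite mulmE; apply/sumsmx_subP => k _; rewrite genmxE. Qed.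

Lemma mulm_sup d (V : 'M[K]_(size (mons n d))) k : (V *m mulX d K k <= mulm V)%MS.
Proof.
rewrite mulmE; apply: (submx_trans _ (sumsmx_sup k _ (submx_refl _))) => //.
by rewrite genmxE.
Qed.

Lemma mulmS d (V W : 'M[K]_(size (mons n d))) : (V <= W)%MS -> (mulm V <= mulm W)%MS.
Proof.
by move=> VW; apply: mulm_subP => k; apply: submx_trans (mulm_sup W k); apply: submxMr.
Qed.

Lemma mulX_rho d k (h : 'M[K]_n) :
  mulX d K k *m rho d.+1 h = \sum_j h j k *: (rho d h *m mulX d K j).
Proof.
apply/row_matrixP => i; rewrite row_mul.
have hX : ('X_[mon i] : {mpoly K[n]}) \is d.-homog by rewrite dhomogX; exact/eqP/mdeg_mon.
have hX1 : ('X_k * 'X_[mon i] : {mpoly K[n]}) \is (d.+1).-homog.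
  by rewrite -mpolyXD dhomogX; apply/eqP; rewrite -[LHS]/(mdeg _) mdegD mdeg1 mdeg_mon.
have -> : row i (mulX d K k) = cf d.+1 ('X_k * 'X_[mon i]).
  by rewrite cf_mulX // cfX rowE.
rewrite -cf_chg // rmorphM /= chgXU mulr_suml (linear_sum (@cf n d.+1 K)) (linear_sum (row i)).
apply: eq_bigr => j _; rewrite -scalerAl linearZ [RHS]linearZ /= cf_mulX ?chg_homog //.
by congr (_ *: _); rewrite row_mul cf_chg // cfX rowE.
Qed.

Lemma mulm_rho d (V : 'M[K]_(size (mons n d))) (h : 'M[K]_n) :
  (mulm V *m rho d.+1 h <= mulm (V *m rho d h))%MS.
Proof.
rewrite (eqmxMr _ (mulmE V)) sumsmxMr; apply/sumsmx_subP => k _; rewrite (eqmxMr _ (genmxE _)).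
rewrite -mulmxA mulX_rho mulmx_sumr; apply: summx_sub => j _.
by rewrite -scalemxAr mulmxA; apply: scalemx_sub; apply: mulm_sup.
Qed.

Section Fixed.
Variable d : nat.
Local Notation N := (size (mons n d)).
Implicit Types (V W : 'M[K]_N) (h g : 'M[K]_n).

(** The rank may drop at 0, so [V'] can be smaller than the true limit space; lower bounds on ranks
    still transfer from [V'] to [V]. *)
Definition degen V V' := exists2 Vt : 'M[{poly K}]_N, ev 0 Vt = V' &
  forall t, t != 0 -> exists2 h, h \in unitmx & (ev t Vt :=: V *m rho d h)%MS.

Lemma rank_rho q (V : 'M[K]_(q, N)) h : h \in unitmx -> \rank (V *m rho d h) = \rank V.
Proof. by move=> hu; rewrite mxrankMfree // row_free_unit rho_unit. Qed.

Lemma rank_adds_rho V W h : h \in unitmx ->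
  \rank (V *m rho d h + W *m rho d h)%MS = \rank (V + W)%MS.
Proof.
move=> hu; have := addsmxMr V W (rho d h); move=> [E _].
by rewrite -E rank_rho.
Qed.

Definition transverse c V W := exists2 g, g \in unitmx & (c <= \rank (V + W *m rho d g)%MS)%N.

Lemma transverseC c V W : transverse c V W -> transverse c W V.
Proof.
move=> [g gu h]; have giu : invmx g \in unitmx by rewrite unitmx_inv.
exists (invmx g); first exact: giu.
apply: leq_trans h _.
have E : V *m rho d (invmx g) *m rho d g = V.
  by rewrite -mulmxA -rhoM mulmxV // rho1 mulmx1.
apply: leq_trans (eq_leq (rank_adds_rho W (V *m rho d (invmx g)) gu)).
by rewrite E addsmxC leqnn.
Qed.

(** Moving [V] by [h] and [W] by [g] has the same effect on the rank of the sum as moving [W] alone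
    by [invmx h *m g]. *)
Lemma degen_transverse c V V' W : degen V V' -> transverse c V' W -> transverse c V W.
Proof.
move=> [Vt V0 Vh] [g gu cV].
have [t t0 ht] := poly_rank charK0 (col_mx Vt (map_mx polyC (W *m rho d g))).
have [h hu Eh] := Vh t t0.
move: ht; rewrite /ev !map_col_mx -!/(ev _ _) !evC V0 -!addsmxE => ht.
exists (invmx h *m g); first by rewrite unitmx_mul unitmx_inv hu.
have E : W *m rho d (invmx h *m g) *m rho d h = W *m rho d g.
  by rewrite -mulmxA -rhoM mulmxA mulmxV // mul1mx.
apply: leq_trans (eq_leq (rank_adds_rho V (W *m rho d (invmx h *m g)) hu)); rewrite E.
have [<- _] := adds_eqmx Eh (eqmx_refl (W *m rho d g)).
exact: leq_trans cV ht.
Qed.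

Lemma degen_mulm V V' : degen V V' -> (\rank (mulm V') <= \rank (mulm V))%N.
Proof.
move=> [Vt V0 Vh]; have [t t0] := poly_rank charK0 (mulm Vt).
have [h hu Eh] := Vh t t0; rewrite !ev_mulm V0 => /leq_trans; apply.
apply: leq_trans (mxrankS (mulmS (_ : (_ <= V *m rho d h)%MS))) _; first by rewrite Eh.
have hi : invmx h \in unitmx by rewrite unitmx_inv.
have := mxrankS (mulm_rho (V *m rho d h) (invmx h)).
by rewrite -mulmxA rho_inv // mulmx1 mxrankMfree // row_free_unit rho_unit.
Qed.

Lemma degen_rank V V' : degen V V' -> (\rank V' <= \rank V)%N.
Proof.
move=> [Vt V0 Vh]; have [t t0] := poly_rank charK0 Vt.
by have [h hu ->] := Vh t t0; rewrite V0 rank_rho.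
Qed.

Definition wt (a : 'I_n -> nat) (i : 'I_N) := (\sum_k a k * mon i k)%N.

(* Scaling x_k by t^(a k) multiplies the leading monomial of each reduced row by the
   lowest power of t occurring in that row. *)
Lemma degen_reduced a V h0 A E : h0 \in unitmx -> (E :=: V *m rho d h0)%MS ->
  reduced (wt a) A E -> degen V (dset K A).
Proof.
move=> h0u EV [E0 E1 Ew].
pose Vt : 'M[{poly K}]_N := \matrix_(i, j) (E i j *: 'X^(wt a j - wt a i)).
exists Vt => [|t t0].
  apply/matrixP => i j; rewrite dsetE !mxE /horner_eval hornerZ hornerXn expr0n.
  case: (eqVneq i j) => [<-|ij] /=.
    rewrite subnn eqxx mulr1; case: (boolP (i \in A)) => [/E1|/E0] -> //.
  case: (eqVneq (E i j) 0) => [->|/Ew]; first by rewrite mul0r.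
  by rewrite eq_sym ij => /(_ isT); rewrite -subn_gt0 lt0n => /negPf->; rewrite mulr0.
pose D := diag_mx (\row_k t ^+ a k) : 'M[K]_n.
have Du : D \in unitmx.
  by rewrite unitmxE det_diag unitfE; apply/prodf_neq0 => k _; rewrite mxE expf_neq0.
exists (D *m h0); first by rewrite unitmx_mul Du.
pose L := diag_mx (\row_i (t ^+ wt a i)^-1) : 'M[K]_N.
have Lu : L \in unitmx.
  by rewrite unitmxE det_diag unitfE; apply/prodf_neq0 => k _; rewrite mxE invr_neq0 ?expf_neq0.
rewrite rhoM mulmxA; apply: eqmx_trans (eqmxMr _ EV).
suff -> : ev t Vt = L *m (E *m rho d D) by apply: eqmxMfull; rewrite row_full_unit.
apply/matrixP => i j; rewrite mul_diag_mx rho_diag mul_mx_diag !mxE.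
rewrite /horner_eval hornerZ hornerXn.
have -> : \prod_k (\row_k0 t ^+ a k0) 0 k ^+ mon j k = t ^+ wt a j.
  by rewrite /wt expr_sum; apply: eq_bigr => k _; rewrite mxE exprM.
case: (eqVneq (E i j) 0) => [->|Eij]; first by rewrite !mul0r mulr0.
have le : (wt a i <= wt a j)%N.
  by case: (eqVneq j i) => [->//|ji]; apply: ltnW; apply: Ew.
by rewrite -[in RHS](subnK le) exprD mulrCA [X in _ = _ * X]mulrC -mulrA divff ?mulr1 ?expf_neq0.
Qed.

(** One inequality is semicontinuity along the degeneration; the other holds since [E] has nonzero
    rows only in [A]. *)
Lemma reduced_card a V h0 A E : h0 \in unitmx -> (E :=: V *m rho d h0)%MS ->
  reduced (wt a) A E -> #|A| = \rank V.
Proof.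
move=> h0u EV red; apply/eqP; rewrite eqn_leq -(rank_dset K A).
apply/andP; split; first exact: degen_rank (degen_reduced h0u EV red).
by rewrite -(rank_rho V h0u) -EV -(reduced_mul red) mxrankM_maxl.
Qed.

End Fixed.
End Degen.

(** * Weights and shears *)

Lemma step_nth l l' : step l l' -> exists2 j, (j.+1 < size l)%N &
  forall i, (nth 0 l i + (i == j.+1) = nth 0 l' i + (i == j))%N.
Proof.
elim=> {l l'} [e f s|k s s' _ [j js jE]].
  by exists 0%N => // -[|[|i]] /=; rewrite ?addn0 ?addn1.
by exists j.+1 => // -[|i] //=; rewrite !eqSS jE.
Qed.

Lemma step_mlst n l l' : step l l' -> size l = n -> exists p q : 'I_n,
  (p < q)%N /\ (mlst n l + U_(p) = mlst n l' + U_(q))%MM.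
Proof.
move=> st sl; have [sl' _ _] := step_props st; have [j jl jE] := step_nth st.
have qn : (n - j.+1 < n)%N by lia.
have pn : (n - j.+2 < n)%N by lia.
exists (Ordinal pn), (Ordinal qn); split; first by rewrite /=; lia.
apply/mnmP => i; rewrite !mnmDE !nth_mlst !mnm1E.
rewrite !nth_rev ?sl' ?sl //; have := jE (n - i.+1)%N; rewrite -!val_eqE /=.
have -> : (n - j.+2 == i)%N = (n - i.+1 == j.+1)%N by have := ltn_ord i; lia.
by have -> : (n - j.+1 == i)%N = (n - i.+1 == j)%N by have := ltn_ord i; lia.
Qed.

Lemma red_nth l : (0 < deg l)%N -> exists2 j, (j < size l)%N &
  forall i, (nth 0 l i = nth 0 (red l) i + (i == j))%N.
Proof.
elim: l => [//|[|k] s IH] /= h.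
  by have [j js jE] := IH h; exists j.+1 => // -[|i] //=; rewrite eqSS jE.
by exists 0%N => // -[|i] /=; rewrite ?addn0 ?addn1.
Qed.

Lemma red_mlst n l : size l = n -> (0 < deg l)%N ->
  exists k : 'I_n, (mlst n l = mlst n (red l) + U_(k))%MM.
Proof.
move=> sl dl; have [j jl jE] := red_nth dl.
have kn : (n - j.+1 < n)%N by lia.
exists (Ordinal kn); apply/mnmP => i; rewrite mnmDE !nth_mlst mnm1E.
rewrite !nth_rev ?size_red ?sl // jE -val_eqE /=.
by congr addn; have := ltn_ord i; lia.
Qed.

Lemma digits_bound n B (y : nat -> nat) : (forall k, k < n -> y k < B)%N ->
  (\sum_(k < n) B ^ k * y k < B ^ n)%N.
Proof.
elim: n => [|n IH] yB; first by rewrite big_ord0.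
rewrite big_ord_recr /= expnS.
have h1 := IH (fun k kn => yB k (ltnW kn)); have := yB n (leqnn _) => h2.
have : (B ^ n * (y n).+1 <= B ^ n * B)%N by rewrite leq_mul2l h2 orbT.
by rewrite mulnS (mulnC B); apply: leq_trans; rewrite -addSn leq_add2r.
Qed.

(** Comparison of numerals in base [B] at their most significant differing digit. *)
Lemma digits_lt n B (x y : nat -> nat) i : (i < n)%N -> (y i < x i)%N ->
  (forall j, i < j -> j < n -> x j = y j)%N -> (forall k, k < n -> y k < B)%N ->
  (\sum_(k < n) B ^ k * y k < \sum_(k < n) B ^ k * x k)%N.
Proof.
elim: n => [//|n IH]; rewrite ltnS leq_eqVlt => /orP[/eqP->|iN] yx eq yB; rewrite !big_ord_recr /=.
  have := @digits_bound n B y (fun k kn => yB k (ltnW kn)) => h1.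
  have : (B ^ n * (y n).+1 <= B ^ n * x n)%N by rewrite leq_mul2l yx orbT.
  by rewrite mulnS => h2; rewrite (leq_trans _ (leq_addl _ _)) //;
    rewrite (leq_trans _ h2) // -addSn leq_add2r.
by rewrite eq // ltn_add2r; apply: IH => // [j ij jn|k kn];
  [apply: eq => //; apply: ltnW | apply: yB; apply: ltnW].
Qed.

Section Orders.
Variables (n d : nat).
Local Notation N := (size (mons n d)).

Lemma oplex_total (u v : 'X_{1..n}) : u != v -> oplex_gt u v || oplex_gt v u.
Proof.
move=> uv; have [i0 i0P] : exists i, u i != v i.
  apply/existsP; apply: contraNT uv => /existsPn h; apply/eqP/mnmP => i.
  by apply/eqP/negPn/h.
case: (@arg_maxnP _ i0 (fun i => u i != v i) (fun i : 'I_n => nat_of_ord i) i0P) => i iP imax.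
have eqj (j : 'I_n) : (i < j)%N -> u j = v j.
  by move=> ij; apply/eqP/negPn/negP => /imax /=; rewrite leqNgt ij.
apply/orP; case: (ltngtP (u i) (v i)) iP => // h _; [right|left]; apply/existsP; exists i;
  rewrite h; apply/forallP => j; apply/implyP => /eqj->; exact: eqxx.
Qed.

(** The base [d.+1] exceeds every exponent in degree [d], so weights compare like numerals. Smallest
    weight first, [revw] gives the degree reverse lexicographic order; [oplexw] complements it, and
    its smallest weight marks the opposite lex greatest monomial. *)
Definition revw (k : 'I_n) : nat := (d.+1 ^ k)%N.
Definition oplexw (k : 'I_n) : nat := (d.+1 ^ n - d.+1 ^ k)%N.

Lemma mon_le (i : 'I_N) k : (mon i k < d.+1)%N.
Proof. by have := mdeg_mon i; rewrite mdegE (bigD1 k) //=; lia. Qed.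

Lemma wt_revw (i : 'I_N) : wt revw i =
  (\sum_(k < n) d.+1 ^ k * nth 0 (mon i) k)%N.
Proof. by apply: eq_bigr => k _; rewrite (mnm_nth 0%N). Qed.

Lemma oplex_revw (i j : 'I_N) : oplex_gt (mon i) (mon j) -> (wt revw j < wt revw i)%N.
Proof.
move=> /existsP[k /andP[kl /forallP h]]; rewrite !wt_revw; apply: (digits_lt (i := k)) => //.
- by rewrite -!mnm_nth.
- move=> l kl' ln; rewrite -[l]/(nat_of_ord (Ordinal ln)) -!mnm_nth.
  by apply/eqP; have := h (Ordinal ln); rewrite /= kl'.
- by move=> l ln; rewrite -[l]/(nat_of_ord (Ordinal ln)) -!mnm_nth mon_le.
Qed.

Lemma revw_inj : injective (wt revw : 'I_N -> nat).
Proof.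
move=> i j E; apply: mon_inj; apply/eqP/negPn/negP => /oplex_total /orP[] /oplex_revw.
  by rewrite E ltnn.
by rewrite E ltnn.
Qed.

Lemma oplexwE (i : 'I_N) : (wt oplexw i + wt revw i = d * d.+1 ^ n)%N.
Proof.
rewrite /wt -big_split /=.
transitivity (mdeg (mon i) * d.+1 ^ n)%N; last by rewrite mdeg_mon.
rewrite mdegE big_distrl /=; apply: eq_bigr => k _.
rewrite /oplexw /revw -mulnDl subnK; first exact: mulnC.
have kn : (k <= n)%N by apply: ltnW.
exact: leq_pexp2l (ltn0Sn d) kn.
Qed.

Lemma oplexw_lt (i j : 'I_N) : j != i -> (wt oplexw i < wt oplexw j)%N = oplex_gt (mon i) (mon j).
Proof.
move=> ji; have ei := oplexwE i; have ej := oplexwE j.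
apply/idP/idP => [h|/oplex_revw]; last lia.
have /orP[//|/oplex_revw] : oplex_gt (mon i) (mon j) || oplex_gt (mon j) (mon i).
  by apply: oplex_total; rewrite (inj_eq (@mon_inj n d)) eq_sym.
by lia.
Qed.

Lemma oplexw_inj : injective (wt oplexw : 'I_N -> nat).
Proof. by move=> i j E; apply: revw_inj; have := oplexwE i; have := oplexwE j; lia. Qed.
End Orders.

Section Galligo.
Variables (K : fieldType) (n d : nat).
Hypothesis charK0 : [pchar K] =i pred0.
Local Notation N := (size (mons n d)).

(** For distinct [p] and [q], the substitution adding [t] times variable [p] to variable [q]. *)
Definition shear (R : comNzRingType) (p q : 'I_n) (t : R) : 'M[R]_n := 1%:M + t *: delta_mx p q.

Lemma shear_unit p q (t : K) : p != q -> shear p q t \in unitmx.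
Proof.
move=> pq; suff /mulmx1_unit[] : shear p q t *m shear p q (- t) = 1%:M by [].
rewrite /shear mulmxDl mul1mx mulmxDr mulmx1 -scalemxAl -scalemxAr mul_delta_mx_0 1?eq_sym //.
by rewrite !scaler0 addr0 scaleNr addrNK.
Qed.

(** To reach [m'], exactly one of the [m q] factors ['X_q] must contribute its term ['X *: 'X_p];
    the other binomial terms have a different exponent at [p]. *)
Lemma shear_coef p q (m m' : 'X_{1..n}) : p != q -> (m + U_(p) = m' + U_(q))%MM ->
  (chg (shear p q 'X) 'X_[m])@_m' = (m q)%:R *: 'X :> {poly K}.
Proof.
move=> pq mm.
have E i : \sum_(j < n) shear p q ('X : {poly K}) j i *: 'X_j =
    'X_i + (if i == q then 'X *: 'X_p else 0) :> {mpoly {poly K}[n]}.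
  rewrite (bigD1 i) //= /shear !mxE eqxx; case: (eqVneq i q) => [->|iq].
    rewrite eq_sym (negPf pq) /= mulr0 addr0 scale1r; congr (_ + _).
    rewrite (bigD1 p) //= big1 ?addr0 => [|j /andP[jq jp]].
      by rewrite !mxE (negPf pq) !eqxx add0r mulr1.
    by rewrite !mxE (negPf jq) (negPf jp) add0r mulr0 scale0r.
  rewrite andbF mulr0 addr0 scale1r big1 // => j ji.
  by rewrite !mxE (negPf ji) (negPf iq) andbF add0r mulr0 scale0r.
pose m0 := (m - U_(q) *+ m q)%MM.
have m0E k : m0 k = if k == q then 0%N else m k.
  rewrite mnmBE mulmnE mnm1E eq_sym; case: eqP => [->|_]; last by rewrite subn0.
  by rewrite mul1n subnn.
have -> : chg (shear p q 'X) 'X_[m] = 'X_[m0] * ('X_q + 'X *: 'X_p) ^+ m q :> {mpoly {poly K}[n]}.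
  rewrite chgX (bigD1 q) //= E eqxx mulrC; congr (_ * _).
  rewrite mpolyXE_id [RHS](bigD1 q) //= m0E eqxx expr0 mul1r; apply: eq_bigr => i iq.
  by rewrite E m0E (negPf iq) addr0.
rewrite exprDn mulr_sumr raddf_sum /=.
have mq0 : (0 < m q)%N.
  have := congr1 (fun m : 'X_{1..n} => m q) mm.
  by rewrite /= !mnmDE !mnm1E eqxx (negPf pq) addn0 addn1 => ->.
have oneq : (1 < (m q).+1)%N by [].
have term i : ('X_[m0] * ('X_q ^+ (m q - i) * ('X *: 'X_p) ^+ i *+ 'C(m q, i)))@_m' =
   (((m0 + (U_(q) *+ (m q - i) + U_(p) *+ i))%MM == m')%:R * 'X^i) *+ 'C(m q, i) :> {poly K}.
  rewrite mulrnAr mcoeffMn exprZn -scalerAr -scalerAr mcoeffZ !mpolyXn -!mpolyXD mcoeffX.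
  by rewrite mulrC.
rewrite (bigD1 (Ordinal oneq)) //= term bin1 expr1.
rewrite [X in (X == m')](_ : _ = m'); last first.
  apply/mnmP => k; rewrite !mnmDE m0E !mulmnE !mnm1E.
  have := congr1 (fun m : 'X_{1..n} => m k) mm; rewrite /= !mnmDE !mnm1E.
  rewrite [k == q]eq_sym; case: (eqVneq q k) => [<-|_]; last by rewrite /=; lia.
  by rewrite (negPf pq) /=; lia.
rewrite eqxx mul1r big1 ?addr0 => [|i i1]; first by rewrite scaler_nat.
rewrite term; case: eqP => [E2|_]; last by rewrite mul0r mul0rn.
case/eqP: i1; apply: val_inj => /=.
have := congr1 (fun m : 'X_{1..n} => m p) E2.
have := congr1 (fun m : 'X_{1..n} => m p) mm.
rewrite /= !mnmDE m0E !mulmnE !mnm1E eqxx (negPf pq) [q == p]eq_sym (negPf pq); lia.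
Qed.

(** This provides the rank hypothesis of [reduced_dominates] for the set in which [u] is exchanged
    for the larger monomial [u']. *)
Lemma shear_rank p q (A : {set 'I_N}) u u' : p != q -> u \in A -> u' \notin A ->
  (mon u + U_(p) = mon u' + U_(q))%MM ->
  exists2 h, h \in unitmx & (#|A| <= \rank (dset K A *m rho d h *m dset K (u' |: A :\ u)))%N.
Proof.
move=> pq uA u'A mm; set A1 := u' |: A :\ u.
pose R := rho d (shear p q ('X : {poly K})).
have evR t : ev t R = rho d (shear p q t).
  rewrite /ev rho_map; congr rho; apply/matrixP => i j.
  by rewrite !mxE rmorphD rmorphM /= !rmorph_nat /horner_eval hornerX.
have R0 i j : (R i j).[0] = (i == j)%:R.
  have := evR 0; rewrite /shear scale0r addr0 rho1 => /matrixP/(_ i j).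
  by rewrite !mxE.
(* At [t = 0] the shear is the identity, so row [u] vanishes on the columns [A1] and may be divided
   by [t]. In the limit it has at [u'] the exponent of [mon u] at [q], nonzero in characteristic 0,
   while the other rows of [A] become unit vectors. *)
pose M : 'M[{poly K}]_N := \matrix_(i, j)
  (((i \in A) && (j \in A1))%:R * (if i == u then drop_poly 1 (R i j) else R i j)).
have uu' : u' != u by apply: contraNneq u'A => ->.
have uA1 : u \notin A1 by rewrite !inE eqxx /= orbF eq_sym.
have cA1 : #|A1| = #|A|.
  by rewrite cardsU1 !inE (negPf u'A) andbF /= [in RHS](cardsD1 u) uA.
have rk0 : (#|A| <= \rank (ev 0 M))%N.
  rewrite -cA1 -(rank_dset K A1); apply: mxrankS.
  have M0 i j : i != u -> ev 0 M i j = ((i == j) && (i \in A) && (j \in A1))%:R.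
    move=> iu; rewrite !mxE (negPf iu) /horner_eval hornerM R0 -[X in X * _]/(horner_eval 0 _).
    by rewrite rmorph_nat -natrM mulnb andbC -andbA.
  have e v : v \in A :\ u -> ((delta_mx 0 v : 'rV[K]_N) <= ev 0 M)%MS.
    rewrite !inE => /andP[vu vA].
    suff -> : (delta_mx 0 v : 'rV[K]_N) = row v (ev 0 M) by apply: row_sub.
    apply/rowP => j; rewrite [RHS]mxE M0 // mxE eqxx /= vA andbT eq_sym.
    by case: eqP => //= <-; rewrite !inE vu vA orbT.
  have e' : ((delta_mx 0 u' : 'rV[K]_N) <= ev 0 M)%MS.
    pose c := ev 0 M u u'.
    have c0 : c != 0.
      rewrite /c !mxE eqxx uA !inE eqxx /= mul1r /horner_eval horner_coef0 coef_drop_poly.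
      rewrite rhoE shear_coef // coefZ coefX mulr1.
      have /pcharf0P -> := charK0; have := congr1 (fun m : 'X_{1..n} => m q) mm.
      by rewrite /= !mnmDE !mnm1E eqxx (negPf pq); lia.
    rewrite -[delta_mx 0 u' : 'rV[K]_N]scale1r -(mulVf c0) -scalerA; apply: scalemx_sub.
    have -> : c *: delta_mx 0 u' = row u (ev 0 M) - \sum_(v in A :\ u) ev 0 M u v *: delta_mx 0 v.
      apply/rowP => j.
      have dE v l : (delta_mx 0 v : 'rV[K]_N) 0 l = (l == v)%:R by rewrite mxE.
      have S : (\sum_(v in A :\ u) ev 0 M u v *: (delta_mx 0 v : 'rV[K]_N)) 0 j =
          if j \in A :\ u then ev 0 M u j else 0.
        rewrite summxE; case: ifP => jB; last first.
          rewrite big1 // => v vB; rewrite mxE dE; case: eqP => [jv|_]; last by rewrite mulr0.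
          by rewrite jv vB in jB.
        rewrite (bigD1 j) //= big1 ?addr0 => [|v /andP[_ vj]].
          by rewrite [LHS]mxE dE eqxx mulr1.
        by rewrite [LHS]mxE dE eq_sym (negPf vj) mulr0.
      have Z k : k \notin A1 -> ev 0 M u k = 0.
        move=> kA1; rewrite !mxE (negPf kA1) andbF mul0r /horner_eval; exact: horner0.
      rewrite [LHS]mxE [RHS]mxE [X in _ = X + _]mxE [X in _ = _ + X]mxE S dE.
      case: (eqVneq j u') => [->|ju'].
        by rewrite !inE (negPf u'A) andbF subr0 mulr1.
      rewrite mulr0; case: ifP => jB; first by rewrite subrr.
      by rewrite Z ?subr0 // in_setU1 (negPf ju') jB.
    rewrite addmx_sub ?row_sub // -scaleN1r scalemx_sub // summx_sub // => v vA.
    by rewrite scalemx_sub // e.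
  apply/row_subP => i; rewrite row_diag_mx !mxE; have [iA1|] := boolP (i \in A1); last first.
    by rewrite scale0r sub0mx.
  by rewrite scale1r; move: iA1; rewrite in_setU1 => /orP[/eqP->|/e//].
have [t t0 ht] := poly_rank charK0 M.
exists (shear p q t); first exact: shear_unit.
apply: leq_trans rk0 (leq_trans ht _); apply: mxrankS.
pose D := diag_mx (\row_i (if i == u then t^-1 else 1)) : 'M[K]_N.
suff -> : ev t M = D *m (dset K A *m rho d (shear p q t) *m dset K A1) by apply: submxMl.
apply/matrixP => i j; rewrite mul_diag_mx [RHS]mxE mul_mx_dset mul_dset -evR !mxE.
rewrite /horner_eval hornerM -[X in X * _]/(horner_eval t _) rmorph_nat.
have [iA|iA] := boolP (i \in A); last by rewrite !mul0r mulr0.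
have [jA|jA] := boolP (j \in A1); last by rewrite mul0r !mulr0.
rewrite !mul1r mulr1; case: (eqVneq i u) => [iu|_]; last by rewrite mul1r.
have ij : i != j by apply: contraNneq uA1 => ij; rewrite -iu ij.
rewrite -{2}(poly_take_drop 1 (R i j)) hornerD hornerM hornerXn expr1.
have -> : take_poly 1 (R i j) = 0.
  apply/polyP => -[|k]; rewrite coef_take_poly coef0 //= -horner_coef0 R0.
  by rewrite (negPf ij).
by rewrite horner0 add0r mulrC mulfK.
Qed.
End Galligo.

(** * Strongly stable limits *)

Section Limits.
Variables (K : fieldType) (n : nat).
Hypothesis charK0 : [pchar K] =i pred0.

Definition listp d (A : {set 'I_(size (mons n d))}) : pred (seq nat) :=
  fun l => [exists i in A, lsti i == l].

Lemma listpE d (A : {set 'I_(size (mons n d))}) i : listp A (lsti i) = (i \in A).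
Proof.
apply/existsP/idP => [[j /andP[jA /eqP/lsti_inj <-]] //|iA].
by exists i; rewrite iA eqxx.
Qed.

Lemma cnt_listp d (A : {set 'I_(size (mons n d))}) : cnt n d (listp A) = #|A|.
Proof. by rewrite cnt_card; apply: eq_card => i; rewrite inE listpE. Qed.

Section Fixed.
Variable d : nat.
Local Notation N := (size (mons n d)).
Local Notation w := (wt (@revw n d)).

Lemma below_swap (A : {set 'I_N}) u u' s : u \in A -> u' \notin A -> (w u' < w u)%N ->
  (#|below w s A| <= #|below w s (u' |: A :\ u)|)%N /\
  (s = w u' -> #|below w s A| < #|below w s (u' |: A :\ u)|)%N.
Proof.
move=> uA u'A ww; pose B := below w s (A :\ u).
have E1 : #|below w s A| = ((w u <= s)%N + #|B|)%N.
  case: (leqP (w u) s) => us /=.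
    have -> : below w s A = u |: B.
      by apply/setP => x; rewrite !inE; case: eqVneq => [->|] //=; rewrite uA us.
    by rewrite cardsU1 !inE eqxx.
  congr #|pred_of_set _|; apply/setP => x; rewrite !inE; case: eqVneq => [->|] //=.
  by rewrite leqNgt us andbF.
have E2 : #|below w s (u' |: A :\ u)| = ((w u' <= s)%N + #|B|)%N.
  case: (leqP (w u') s) => us /=.
    have -> : below w s (u' |: A :\ u) = u' |: B.
      by apply/setP => x; rewrite !inE; case: (eqVneq x u') => [->|] //=.
    by rewrite cardsU1 !inE (negPf u'A) andbF.
  congr #|pred_of_set _|; apply/setP => x; rewrite !inE; case: (eqVneq x u') => [->|] //=.
  by rewrite leqNgt us !andbF.
rewrite E1 E2; split=> [|->]; lia.
Qed.

(* Galligo's argument: if a monomial space is not closed under the replacement of a variable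
   by the preceding one, a shear followed by a degeneration moves it strictly up. *)
Lemma stable_limit (P : 'M[K]_N -> Prop) V :
  (forall V V', degen V V' -> P V' -> P V) ->
  exists A : {set 'I_N}, [/\ #|A| = \rank V, stable (listp A) & P (dset K A) -> P V].
Proof.
move=> HP; pose Mx := (\max_(i < N) w i).+1.
(* [Phi] is bounded and grows whenever weight moves down, so it controls the iteration. *)
pose Phi (A : {set 'I_N}) := (\sum_(s < Mx) #|below w s A|)%N.
have init U h0 : h0 \in unitmx -> exists A E, [/\ (E :=: U *m rho d h0)%MS,
    reduced w A E, #|A| = \rank U & P (dset K A) -> P U].
  move=> h0u; have [A [E [EV red _]]] := echelon (@revw_inj n d) (U *m rho d h0).
  exists A, E; split=> //; first exact: (reduced_card charK0 h0u EV red).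
  by apply: HP; apply: degen_reduced h0u EV red.
have Phi_le A : (Phi A <= Mx * N)%N.
  rewrite /Phi -[X in (_ <= X * _)%N]card_ord -sum_nat_const; apply: leq_sum => s _.
  by rewrite -[X in (_ <= X)%N]card_ord max_card.
have [A0 [E0 [_ _ c0 P0]]] := init V 1%:M (unitmx1 _ _).
suff [A [cA sA PA]] : exists A : {set 'I_N},
    [/\ #|A| = #|A0|, stable (listp A) & P (dset K A) -> P (dset K A0)].
  by exists A; split=> //; [rewrite cA | move=> /PA/P0].
move: {c0 P0} A0 => A0; move E : (Mx * N - Phi A0)%N => k.
elim/ltn_ind: k A0 E => k IH A0 Ek.
have [st|nst] := classic (stable (listp A0)); first by exists A0.
have [l [l' [ll' Al nAl']]] : exists l l', [/\ step l l', listp A0 l & ~ listp A0 l'].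
  apply: NNPP => no; apply: nst => l l' ll' Al; apply: NNPP => nAl'; apply: no.
  by exists l, l'.
have [u uA ul] : exists2 u, u \in A0 & lsti u = l by case/exists_inP: Al => u uA /eqP; exists u.
have [sl' dl' _] := step_props ll'.
have lm := lsti_mons u; rewrite ul in lm.
have [u' ul'] : exists u' : 'I_N, lsti u' = l'.
  by apply: lsti_surj; move: lm; rewrite !mem_mons sl' dl'.
have u'A : u' \notin A0 by apply/negP => u'A; apply: nAl'; rewrite -ul' listpE.
have [p [q [pq mm]]] := step_mlst ll' (mons_size lm).
rewrite -ul -ul' -!/(mon _) in mm.
have pq' : p != q by rewrite -val_eqE /= ltn_eqF.
have ww : (w u' < w u)%N.
  apply: oplex_revw; apply/existsP; exists q.
  have mE k := congr1 (fun m : 'X_{1..n} => m k) mm.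
  apply/andP; split.
    by have := mE q; rewrite /= !mnmDE !mnm1E eqxx (negPf pq'); lia.
  apply/forallP => j; apply/implyP => qj; apply/eqP; have := mE j.
  rewrite /= !mnmDE !mnm1E; have -> : (p == j) = false by apply/eqP => pj; rewrite -pj in qj; lia.
  by have -> : (q == j) = false by [apply/eqP => pj; rewrite -pj in qj; lia]; rewrite !addn0.
have [h hu hr] := shear_rank charK0 pq' uA u'A mm.
have [A [E [EV red cA PA]]] := init (dset K A0) h hu.
have c1 : #|u' |: A0 :\ u| = #|A0|.
  by rewrite cardsU1 !inE (negPf u'A) andbF /= [in RHS](cardsD1 u) uA.
(* The new initial set [A] dominates the exchanged set, which itself strictly dominates [A0] at the
   weight of [u']. *)
have dom s : (#|below w s (u' |: A0 :\ u)| <= #|below w s A|)%N.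
  apply: (reduced_dominates s red); rewrite c1; apply: leq_trans hr _.
  by have [-> _] := eqmxMr (dset K (u' |: A0 :\ u)) EV.
have up : (Phi A0 < Phi A)%N.
  have su : (w u' < Mx)%N by rewrite ltnS; apply: (leq_bigmax (F := w)).
  rewrite /Phi (bigD1 (Ordinal su)) //= [X in (_ < X)%N](bigD1 (Ordinal su)) //= -addSn.
  apply: leq_add; last apply: leq_sum => s _.
    by apply: leq_trans (dom _); apply: (below_swap _ uA u'A ww).2.
  by apply: leq_trans (dom _); apply: (below_swap _ uA u'A ww).1.
have [|A' [cA' sA' PA']] := IH (Mx * N - Phi A)%N _ A erefl.
  by have := Phi_le A; lia.
exists A'; split=> //; last by move=> /PA'/PA.
by rewrite cA' cA rank_dset.
Qed.

(** By [degen_mulm] it suffices to treat a stable limit [A]. There [growth] applies, and a monomial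
    whose reduction lies in [A] is a variable times a member of [A]. *)
Lemma macaulay (V : 'M[K]_N) L : lexset n d L -> (cnt n d L <= \rank V)%N ->
  (cnt n d.+1 (fun l => L (red l)) <= \rank (mulm V))%N.
Proof.
move=> lL LV; set c := cnt _ _ _.
have HP (U U' : 'M[K]_N) : degen U U' -> (c <= \rank (mulm U'))%N -> (c <= \rank (mulm U))%N.
  by move=> UU' /leq_trans; apply; apply: degen_mulm.
have [A [cA sA PA]] := stable_limit V HP; apply: PA.
apply: leq_trans (@growth n d (listp A) L sA lL _) _; first by rewrite cnt_listp cA.
rewrite cnt_card -(rank_dset K); apply: mxrankS.
apply/row_subP => j; rewrite row_diag_mx !mxE inE.
have [jA|] := boolP (listp A (red (lsti j))); last by rewrite scale0r sub0mx.
rewrite scale1r; case/existsP: jA => i /andP[iA /eqP ij].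
have [|k kE] := @red_mlst n (lsti j) (mons_size (lsti_mons j)).
  by rewrite (mons_sum (lsti_mons j)).
apply: submx_trans (mulm_sup (dset K A) k).
suff -> : (delta_mx 0 j : 'rV[K]_(size (mons n d.+1))) = row i (dset K A *m mulX d K k).
  exact: row_sub.
apply/rowP => j'; rewrite mxE [RHS]mxE mul_dset iA mul1r mxE eqxx /=.
have -> : (mon i + U_(k))%MM = mon j by rewrite /mon kE ij.
by rewrite (inj_eq (@mon_inj n d.+1)).
Qed.

Lemma transverse_lex (V W : 'M[K]_N) (L : pred (seq nat)) (B : {set 'I_N}) :
  lexset n d L -> cnt n d L = \rank V -> degen W (dset K B) ->
  rdown n d (fun l => ~~ listp B l) ->
  transverse #|[set i | L (lsti i)] :|: B| V W.
Proof.
move=> lL LV WB dB.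
have HP (U U' : 'M[K]_N) : degen U U' -> transverse #|[set i | L (lsti i)] :|: B| U' W ->
    transverse #|[set i | L (lsti i)] :|: B| U W.
  by move=> UU'; apply: degen_transverse.
have [A [cA sA PA]] := stable_limit V HP; apply: PA.
(* The sides are exchanged so that [W] can be degenerated as well. *)
apply: transverseC; apply: (degen_transverse charK0 WB).
exists 1%:M; first exact: unitmx1.
rewrite rho1 mulmx1 dset_addsmx rank_dset.
have := @cnt_rdown n d (listp A) L _ sA lL dB; rewrite cnt_listp cA LV => /(_ (leqnn _)).
rewrite !cnt_card.
have -> : [set i | predI L (fun l => ~~ listp B l) (lsti i)] = [set i | L (lsti i)] :\: B.
  by apply/setP => i; rewrite !inE /= listpE andbC.
have -> : [set i | predI (listp A) (fun l => ~~ listp B l) (lsti i)] = A :\: B.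
  by apply/setP => i; rewrite !inE /= !listpE andbC.
have UE (X : {set 'I_N}) : #|X :|: B| = (#|B| + #|X :\: B|)%N.
  by rewrite cardsU cardsD; have := subset_leq_card (subsetIl X B); lia.
by rewrite (setUC B) !UE leq_add2l.
Qed.
End Fixed.
End Limits.

(** * Homogeneous components of ideals *)

Definition asb (P : Prop) : bool := if excluded_middle_informative P then true else false.

Lemma asbP P : reflect P (asb P).
Proof. by rewrite /asb; case: excluded_middle_informative => h; constructor. Qed.

(** A matrix with rows in [Q] is enlarged as long as a vector of [Q] is missing; each enlargement
    raises the rank, which is at most [N]. *)
Lemma subspace_mx (K : fieldType) N (Q : 'rV[K]_N -> Prop) :
  Q 0 -> (forall a u v, Q u -> Q v -> Q (a *: u + v)) ->
  exists V : 'M[K]_N, forall v, Q v <-> (v <= V)%MS.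
Proof.
move=> Q0 QD.
suff [V VQ VP] : exists2 V : 'M[K]_N, (forall v, (v <= V)%MS -> Q v) &
    forall v, Q v -> (v <= V)%MS by exists V => v; split; [apply: VP | apply: VQ].
suff base k : (exists2 V : 'M[K]_N, (forall v, (v <= V)%MS -> Q v) & (N - \rank V <= k)%N) ->
    exists2 V : 'M[K]_N, (forall v, (v <= V)%MS -> Q v) & forall v, Q v -> (v <= V)%MS.
  by apply: (base N); exists 0; [move=> v; rewrite submx0 => /eqP-> | rewrite leq_subr].
elim: k => [|k IH] [V VQ rV].
  by exists V => // v _; apply: submx_full; rewrite /row_full eqn_leq rank_leq_col; lia.
have [VP|nVP] := classic (forall v, Q v -> (v <= V)%MS); first by exists V.
have [v [Qv nv]] : exists v, Q v /\ ~ (v <= V)%MS.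
  apply: NNPP => no; apply: nVP => v Qv; apply: NNPP => nv; apply: no; by exists v.
apply: IH; exists (V + v)%MS.
  move=> x /sub_addsmxP[[D1 D2] ->].
  rewrite -[D1 *m V]scale1r; apply: (QD _ _ _ _ _); first by apply: VQ; apply: submxMl.
  by rewrite [D2]mx11_scalar mul_scalar_mx -[_ *: v]addr0; apply: QD.
have : (\rank V < \rank (V + v)%MS)%N.
  rewrite ltnNge (geq_leqif (mxrank_leqif_sup (addsmxSl V v))).
  by apply: contra_notN nv; rewrite addsmx_sub => /andP[].
by have := rank_leq_col (V + v)%MS; lia.
Qed.

Section Component.
Variables (n : nat) (K : fieldType).
Local Notation S := {mpoly K[n]}.
Local Notation N d := (size (mons n d)).
Implicit Types I J L : S -> Prop.

Lemma ideal_scale I c p : is_ideal I -> I p -> I (c *: p).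
Proof. by move=> [_ _ IM] Ip; rewrite -mul_mpolyC; apply: IM. Qed.

Definition component I d (V : 'M[K]_(N d)) :=
  forall p, p \is d.-homog -> (I p <-> (cf d p <= V)%MS).

Lemma component_ex I d : is_ideal I -> exists V : 'M[K]_(N d), component I V.
Proof.
move=> idI; have [I0 ID IM] := idI.
have [|a u v Iu Iv|V VP] := @subspace_mx K (N d) (fun v => I (pol v)).
- by rewrite linear0.
- by rewrite linearD linearZ; apply: ID => //; apply: ideal_scale.
by exists V => p hp; rewrite -VP cfK.
Qed.

(** [dimension] is a chosen length of a basis: a basis must first be exhibited, and then the chosen
    one, whatever it is, is shown to have length [\rank V]. *)
Lemma hilbert_component I d (V : 'M[K]_(N d)) : component I V -> hilbert I d = \rank V.
Proof.
move=> IV; pose P p := I p /\ p \is d.-homog.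
have PP p : P p <-> p \is d.-homog /\ (cf d p <= V)%MS.
  by split=> -[h1 h2]; split=> //; apply/IV.
have lin k (e : k.-tuple S) (c : 'rV[K]_k) (E := \matrix_(i < k) cf d (tnth e i)) :
    cf d (\sum_(i < k) c 0 i *: tnth e i) = c *m E.
  rewrite (linear_sum (@cf n d K)) mulmx_sum_row; apply: eq_bigr => i _.
  by rewrite linearZ rowK.
rewrite /hilbert /dimension; set ex := fun k => _.
have : ex (epsilon (inhabits 0%N) ex).
  apply: epsilon_spec; exists (\rank V), [tuple pol (row i (row_base V)) | i < \rank V].
  split=> [i|p /PP[hp]].
    rewrite tnth_mktuple; apply/PP; split; first exact: pol_homog.
    by rewrite polK (submx_trans (row_sub _ _)) ?eq_row_base.
  rewrite -(eq_row_base V) => /submxP[c cE]; exists c.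
  have E : \matrix_(i < \rank V) cf d (tnth [tuple pol (row i (row_base V)) | i < \rank V] i)
      = row_base V by apply/row_matrixP => i; rewrite rowK tnth_mktuple polK.
  split.
    rewrite -(cfK hp) cE -[in RHS](@cfK n d K (\sum_i _)); first by rewrite lin E.
    by apply: rpred_sum => i _; apply: rpredZ; rewrite tnth_mktuple pol_homog.
  move=> c' /(congr1 (@cf n d K)); rewrite lin E cE.
  by move/row_free_inj; apply; apply: row_base_free.
move: (epsilon _ _) => k [e [eP eU]].
pose E := \matrix_(i < k) cf d (tnth e i).
have fE : row_free E.
  apply: inj_row_free => c; rewrite -lin => c0.
  have hom : \sum_(i < k) c 0 i *: tnth e i \is d.-homog.
    by apply: rpred_sum => i _; apply: rpredZ; have [] := eP i.
  have := cfK hom; rewrite c0 linear0 => s0.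
  have [|x [_ xU]] := eU 0.
    by apply/PP; split; [apply: rpred0 | rewrite linear0 sub0mx].
  rewrite -(xU c s0); apply: xU; rewrite big1 // => i _; by rewrite mxE scale0r.
rewrite -(eqP fE : \rank E = k); apply/eqP; rewrite eqn_leq; apply/andP; split; apply: mxrankS.
  by apply/row_subP => i; rewrite rowK; have /PP[] := eP i.
apply/row_subP => i; have [|c [cE _]] := eU (pol (row i V)).
  by apply/PP; rewrite polK row_sub; split=> //; apply: pol_homog.
by rewrite -(polK (row i V)) cE lin submxMl.
Qed.

Lemma component_cap I J d (V W : 'M[K]_(N d)) : component I V -> component J W ->
  component (ideal_inter I J) (V :&: W)%MS.
Proof.
move=> IV JW p hp; rewrite sub_capmx /ideal_inter IV // JW //.
by split=> [[-> ->]|/andP].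
Qed.

Lemma component_mulX I d (V : 'M[K]_(N d)) (V' : 'M[K]_(N d.+1)) k : is_ideal I ->
  component I V -> component I V' -> (V *m mulX d K k <= V')%MS.
Proof.
move=> [_ _ IM] IV IV'; apply/row_subP => i; rewrite row_mul.
have hp := pol_homog (row i V).
rewrite -(polK (row i V)) -cf_mulX //; apply/IV'.
  rewrite -[d.+1]add1n; apply: dhomogM => //; rewrite dhomogX; exact/eqP/mdeg1.
by apply: IM; apply/IV; rewrite // polK row_sub.
Qed.

Lemma chgK (g : 'M[K]_n) p : g \in unitmx -> chg g (chg (invmx g) p) = p.
Proof. by move=> gu; rewrite -chgM mulmxV // chg1. Qed.

Lemma image_ideal (g : 'M[K]_n) I : g \in unitmx -> is_ideal I -> is_ideal (ideal_image g I).
Proof.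
move=> gu [I0 ID IM]; split.
- by exists 0 => //; rewrite [coord_change _ _](raddf0 (chg g)).
- move=> _ _ [p Ip ->] [q Iq ->]; exists (p + q); first exact: ID.
  by rewrite [RHS](raddfD (chg g)).
- move=> r _ [q Iq ->]; exists (chg (invmx g) r * q); first exact: IM.
  by rewrite [RHS](rmorphM (chg g)) /= chgK.
Qed.

Lemma chg_pihomog (g : 'M[K]_n) d p : pihomog mdeg d (chg g p) = chg g (pihomog mdeg d p).
Proof.
apply: (mpoly_linear_ext (f := pihomog mdeg d \o chg g) (g := chg g \o pihomog mdeg d)) => m /=.
have hm : chg g 'X_[m] \is (mdeg m).-homog by apply: chg_homog; rewrite dhomogX.
rewrite pihomogX; case: (eqVneq (mdeg m) d) => [md|md].
  by rewrite pihomog_dE //= -md.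
by rewrite (pihomog_ne0 md hm) (raddf0 (chg g)).
Qed.

Lemma cf_pihomog d (p : S) : cf d (pihomog mdeg d p) = cf d p.
Proof.
apply: (mpoly_linear_ext (f := @cf n d K \o pihomog mdeg d) (g := @cf n d K)) => m /=.
rewrite pihomogX; case: (eqVneq (mdeg m) d) => [md|md] //=.
rewrite linear0; apply/rowP => i; rewrite !mxE mcoeffX.
by case: eqP => // E; rewrite E mdeg_mon eqxx in md.
Qed.

Lemma image_component (g : 'M[K]_n) J d (W : 'M[K]_(N d)) : g \in unitmx ->
  homogeneous_ideal J -> component J W -> component (ideal_image g J) (W *m rho d g).
Proof.
move=> gu [idJ homJ] JW p hp; split.
  move=> [q Jq pE]; rewrite -(cf_pihomog d p) pE [coord_change _ _]/(chg g q) chg_pihomog.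
  by rewrite cf_chg ?pihomogP //; apply: submxMr; apply/JW; [apply: pihomogP | apply: homJ].
move=> /submxP[D DE]; exists (pol (D *m W)); first by apply/JW; rewrite ?pol_homog // polK submxMl.
rewrite -[LHS](cfK hp) DE mulmxA -{1}(polK (D *m W)) -cf_chg ?pol_homog // cfK //.
by apply: chg_homog; apply: pol_homog.
Qed.

Lemma mem_ideal_gen_mon (G : S -> Prop) (W : 'X_{1..n} -> Prop) p :
  (forall q, G q <-> exists2 m, W m & q = 'X_[m]) ->
  ideal_gen G p <-> forall m, m \in msupp p -> exists2 w, W w & (w <= m)%MM.
Proof.
move=> GW; split=> [|h].
  move/(_ (fun p => forall m, m \in msupp p -> exists2 w, W w & (w <= m)%MM)); apply.
    split=> [m|p1 p2 h1 h2 m|p1 p2 h2 m]; first by rewrite msupp0.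
      by move/msuppD_le; rewrite mem_cat => /orP[/h1|/h2].
    move/msuppM_le/allpairsP => [[m1 m2] /= [_ /h2[w Ww wm] ->]]; exists w => //.
    by rewrite (lepm_trans wm) // lem_addl.
  move=> q /GW[w Ww ->] m; rewrite msuppX inE => /eqP->; exists w => //; exact: lepm_refl.
move=> I idI GI; have [I0 ID IM] := idI.
rewrite [p]mpolyE big_seq; elim/big_ind: _ => // m /h[w Ww wm].
apply: ideal_scale => //; rewrite -(submK wm) mpolyXD; apply: IM; apply: GI.
by apply/GW; exists w.
Qed.

Lemma monomial_idealP L p : monomial_ideal L ->
  L p <-> forall m, m \in msupp p -> L 'X_[m].
Proof.
move=> [W LW]; rewrite LW (mem_ideal_gen_mon _ (W := W)) //.
split=> h m mp; last first.
  have := h m mp; rewrite LW (mem_ideal_gen_mon _ (W := W)) //; apply.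
  by rewrite msuppX inE.
rewrite LW (mem_ideal_gen_mon _ (W := W)) // => m'; rewrite msuppX inE => /eqP->; exact: h.
Qed.

Lemma monomial_is_ideal L : monomial_ideal L -> is_ideal L.
Proof.
move=> [W LW]; split; first by apply/LW => I [].
  move=> p q /LW Lp /LW Lq; apply/LW => I idI GI; have [_ ID _] := idI.
  by apply: ID; [apply: Lp | apply: Lq].
move=> p q /LW Lq; apply/LW => I idI GI; have [_ _ IM] := idI.
by apply: IM; apply: Lq.
Qed.

Definition monset L d : {set 'I_(N d)} := [set i | asb (L 'X_[mon i])].

Lemma monsetP L d i : reflect (L 'X_[mon i]) (i \in monset L d).
Proof. by rewrite inE; apply: asbP. Qed.

Lemma monset_component L d : monomial_ideal L -> component L (dset K (monset L d)).
Proof.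
move=> mL p hp; rewrite (monomial_idealP _ mL); split.
  move=> h; apply/sub_dsetP => i j; rewrite mxE => pj.
  by apply/monsetP; apply: h; rewrite mcoeff_msupp.
move=> /sub_dsetP h m mp; have [i im] := mon_surj (dhomog_mf hp mp).
by rewrite -im; apply/monsetP; apply: (h 0); rewrite mxE im -mcoeff_msupp.
Qed.

Lemma hilbert_monset L d : monomial_ideal L -> hilbert L d = #|monset L d|.
Proof. by move=> mL; rewrite (hilbert_component (@monset_component L d mL)) rank_dset. Qed.
End Component.

(** * The opposite lex limit of J *)

Section Reversal.
Variables (n : nat) (K : fieldType).
Local Notation S := {mpoly K[n]}.
Local Notation N d := (size (mons n d)).

Definition mrev (m : 'X_{1..n}) : 'X_{1..n} := [multinom m (rev_ord i) | i < n].
Definition revmx : 'M[K]_n := \matrix_(j, i) (j == rev_ord i)%:R.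

Lemma mrevE m i : mrev m i = m (rev_ord i).
Proof. exact: mnmE. Qed.

Lemma mrevK : involutive mrev.
Proof. by move=> m; apply/mnmP => i; rewrite !mrevE rev_ordK. Qed.

Lemma mdeg_mrev m : mdeg (mrev m) = mdeg m.
Proof.
rewrite !mdegE (reindex_inj rev_ord_inj) /=; apply: eq_bigr => i _.
by rewrite mrevE rev_ordK.
Qed.

Lemma lex_gt_mrev u v : lex_gt (mrev u) (mrev v) = oplex_gt u v.
Proof.
apply/existsP/existsP => -[i /andP[vu /forallP h]]; exists (rev_ord i).
  move: vu; rewrite !mrevE => -> /=; apply/forallP => j; apply/implyP => ij.
  have := h (rev_ord j); rewrite !mrevE rev_ordK => /implyP; apply.
  by move: ij; rewrite /=; have := ltn_ord i; have := ltn_ord j; lia.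
rewrite !mrevE rev_ordK vu; apply/forallP => j; apply/implyP => ij; rewrite !mrevE.
have := h (rev_ord j) => /implyP; apply.
by move: ij; rewrite /=; have := ltn_ord i; have := ltn_ord j; lia.
Qed.

Lemma lex_gt_add2l c (u v : 'X_{1..n}) : lex_gt (c + u)%MM (c + v)%MM = lex_gt u v.
Proof.
apply: eq_existsb => i; rewrite !mnmDE ltn_add2l; congr andb.
by apply: eq_forallb => j; rewrite !mnmDE eqn_add2l.
Qed.

Lemma revmx_unit : revmx \in unitmx.
Proof.
suff /mulmx1_unit[] : revmx *m revmx = 1%:M by [].
apply/matrixP => i j; rewrite !mxE (bigD1 (rev_ord j)) //= !mxE eqxx mulr1 rev_ordK.
rewrite big1 ?addr0 // => k kj; by rewrite !mxE (negPf kj) mulr0.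
Qed.

Lemma chg_revmxX m : chg revmx 'X_[m] = 'X_[mrev m].
Proof.
rewrite chgX mpolyXE_id [RHS](reindex_inj rev_ord_inj) /=; apply: eq_bigr => i _.
rewrite mrevE rev_ordK; congr (_ ^+ _).
rewrite (bigD1 (rev_ord i)) //= mxE eqxx scale1r big1 ?addr0 // => j ji.
by rewrite mxE (negPf ji) scale0r.
Qed.

Lemma mcoeff_chg_revmx p m : (chg revmx p)@_m = p@_(mrev m).
Proof.
rewrite [in LHS](mpolyE p) (linear_sum (chg revmx)) raddf_sum /=.
rewrite [in RHS](mpolyE p) raddf_sum /=; apply: eq_bigr => k _.
rewrite linearZ /= chg_revmxX !mcoeffZ !mcoeffX; congr (_ * _%:R); congr nat_of_bool.
by rewrite -(inj_eq (inv_inj mrevK) k) mrevK.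
Qed.

Lemma mcoeff_pihomog d (p : S) m : mdeg m = d -> (pihomog mdeg d p)@_m = p@_m.
Proof.
move=> md; have [i <-] := mon_surj md.
by have := cf_pihomog d p => /rowP/(_ i); rewrite !mxE.
Qed.

(* The hypotheses on [GinJ] concern the lexicographic order; reversing the variables turns
   them into statements on the opposite one. *)
Lemma degen_gin (charK0 : [pchar K] =i pred0) (J GinJ Joplex : S -> Prop) d (W : 'M[K]_(N d)) :
  homogeneous_ideal J -> is_gin (@lex_gt n) J GinJ -> is_lex_ideal GinJ ->
  is_oplexification J Joplex -> component J W -> degen W (dset K (monset Joplex d)).
Proof.
move=> homJ [U [[F UF] [g Ug] UP]] [_ segG] [[mO segO] HO] JW.
have gu : g \in unitmx by have [/(_ Ug)[]] := UF g.
have gG := UP g Ug.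
have [idJ homJ'] := homJ.
pose gJ := ideal_image g J.
have idgJ : is_ideal gJ by apply: image_ideal.
pose h0 := revmx *m g.
have h0u : h0 \in unitmx by rewrite unitmx_mul revmx_unit.
have [A [E [EV red AP]]] := echelon (@oplexw_inj n d) (W *m rho d h0).
suff <- : A = monset Joplex d by apply: degen_reduced h0u EV red => //.
have cA : #|A| = \rank W by apply: reduced_card h0u EV red => //.
have cO : #|monset Joplex d| = \rank W.
  by rewrite -(hilbert_monset d mO) HO (hilbert_component JW).
(* [i] gives a monomial of [GinJ], and the lex property gives the one of [j]. The latter is a
   multiple of a leading monomial [m0] of some [p0], and [p0] times the quotient yields a vector
   leading at [j]. *)
have Aup i j : i \in A -> oplex_gt (mon j) (mon i) -> j \in A.
  move=> /AP[v [/submxP[D vE] vi vlt]] ji.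
  pose q := pol (D *m W).
  have hq : q \is d.-homog by apply: pol_homog.
  have Jq : J q by apply/JW; rewrite // polK submxMl.
  have gJq : gJ (chg g q) by exists q.
  have vq k : v 0 k = (chg g q)@_(mrev (mon k)).
    by rewrite vE mulmxA -(polK (D *m W)) -cf_chg // mxE chgM mcoeff_chg_revmx.
  have lead : is_lead_monomial (@lex_gt n) (chg g q) (mrev (mon i)).
    split=> [|m mq mi]; first by rewrite mcoeff_msupp -vq vi oner_neq0.
    have [|k km] := @mon_surj n d (mrev m).
      by rewrite mdeg_mrev; apply: (dhomog_mf (chg_homog g hq) mq).
    have mk : m = mrev (mon k) by rewrite km mrevK.
    rewrite mk lex_gt_mrev; have ki : k != i by apply: contraNneq mi => <-; rewrite mk.
    rewrite -oplexw_lt //; apply: vlt ki.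
    by rewrite vq -mk -mcoeff_msupp.
  have Gi : GinJ 'X_[mrev (mon i)].
    by apply/gG => I' _; apply; exists (chg g q), (mrev (mon i)).
  have Gj : GinJ 'X_[mrev (mon j)].
    apply: (segG _ (mrev (mon j)) _ Gi); first by rewrite !mdeg_mrev !mdeg_mon.
    by rewrite lex_gt_mrev.
  have [p0 [m0 [gJp0 [m0p0 lp0] m0j]]] : exists p0 m0, [/\ gJ p0,
      is_lead_monomial (@lex_gt n) p0 m0 & (m0 <= mrev (mon j))%MM].
    move/gG: Gj; rewrite /initial_ideal.
    rewrite (mem_ideal_gen_mon _ (W := fun m =>
      exists p, gJ p /\ is_lead_monomial (@lex_gt n) p m)).
      case/(_ (mrev (mon j))) => [|m0 [p [gJp lp]] mj]; first by rewrite msuppX inE.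
      by exists p, m0.
    move=> r; split=> [[p [m [gJp lp ->]]]|[m [p [gJp lp]] ->]]; last by exists p, m.
    by exists m => //; exists p.
  pose c := (mrev (mon j) - m0)%MM.
  have cm0 : (c + m0)%MM = mrev (mon j) by apply: submK.
  pose p1 := p0 * 'X_[c].
  have [_ _ gJM] := idgJ.
  have gJp1 : gJ p1 by rewrite /p1 mulrC; apply: gJM.
  have p1c m : p1@_(c + m) = p0@_m by apply: mcoeffMX.
  have p1lt m : m \in msupp p1 -> m != mrev (mon j) -> lex_gt (mrev (mon j)) m.
    rewrite /p1 (perm_mem (msuppMX _ _)) => /mapP[m' m'p0 ->].
    rewrite -cm0 => ne; rewrite lex_gt_add2l; apply: lp0 => //.
    by apply: contraNneq ne => ->.
  case: gJp1 => q1 Jq1 p1E.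
  (* [p1] may mix degrees, as [lex_gt] compares monomials of all degrees; the part of degree [d]
     keeps the leading monomial. *)
  pose q2 := pihomog mdeg d q1.
  have hq2 : q2 \is d.-homog by apply: pihomogP.
  have Jq2 : J q2 by apply: homJ'.
  have vq2 k : (cf d q2 *m rho d h0) 0 k = p1@_(mrev (mon k)).
    rewrite -cf_chg // mxE chgM mcoeff_chg_revmx -chg_pihomog mcoeff_pihomog.
      by rewrite p1E.
    by rewrite mdeg_mrev mdeg_mon.
  have p1j : p1@_(mrev (mon j)) != 0 by rewrite -cm0 p1c -mcoeff_msupp.
  apply/AP; exists ((p1@_(mrev (mon j)))^-1 *: (cf d q2 *m rho d h0)); split.
  - by apply: scalemx_sub; apply: submxMr; apply/JW.
  - by rewrite mxE vq2 mulVf.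
  move=> k; rewrite mxE vq2 mulf_eq0 negb_or => /andP[_ pk] kj.
  rewrite oplexw_lt // -lex_gt_mrev; apply: p1lt; first by rewrite mcoeff_msupp.
  by rewrite (inj_eq (inv_inj mrevK)) (inj_eq (@mon_inj n d)).
have Oup i j : i \in monset Joplex d -> oplex_gt (mon j) (mon i) -> j \in monset Joplex d.
  move=> /monsetP Oi ji; apply/monsetP; apply: (segO (mon i)) => //.
  by rewrite !mdeg_mon.
(* Both sets have the same size and are closed upwards for a total order, so they coincide. *)
have [/subsetP AO|/subsetPn[x xA xO]] := boolP (A \subset monset Joplex d).
  by apply/eqP; rewrite eqEcard cA cO leqnn andbT; apply/subsetP.
apply/esym/eqP; rewrite eqEcard cA cO leqnn andbT; apply/subsetP => y yO.
have [//|yA] := boolP (y \in A).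
have xy : mon x != mon y.
  by rewrite (inj_eq (@mon_inj n d)); apply: contraNneq yA => <-.
case/orP: (oplex_total xy) => h; first by rewrite (Oup y) in xO.
by rewrite (Aup x) in yA.
Qed.
End Reversal.

(** * General coordinates in all degrees *)

Lemma lgt_nth l' l : size l' = size l -> lgt l' l -> exists p, [/\ (p < size l)%N,
  (nth 0 l p < nth 0 l' p)%N & forall q, (p < q)%N -> nth 0%N l' q = nth 0%N l q].
Proof.
elim: l' l => [|a s' IH] [|b s] //= [ss] /orP[/(IH _ ss)[p [ps pl pE]]|/andP[/eqP-> ab]].
  by exists p.+1; split=> // -[|q] //=; apply: pE.
by exists 0%N; split=> // -[|q].
Qed.

Lemma rgt_nth l' l : size l' = size l -> rgt l' l -> exists p, [/\ (p < size l)%N,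
  (nth 0 l p < nth 0 l' p)%N & forall q, (q < p)%N -> nth 0%N l' q = nth 0%N l q].
Proof.
elim: l' l => [|a s' IH] [|b s] //= [ss] /orP[ab|/andP[/eqP-> /(IH _ ss)[p [ps pl pE]]]].
  by exists 0%N.
by exists p.+1; split=> // -[|q] //=; apply: pE.
Qed.

Lemma nth_lsti n d (i : 'I_(size (mons n d))) (k : 'I_n) :
  mon i k = nth 0%N (lsti i) (n - k.+1).
Proof. by rewrite nth_mlst nth_rev (mons_size (lsti_mons i)). Qed.

Lemma lgt_lex_gt n d (i j : 'I_(size (mons n d))) :
  lgt (lsti j) (lsti i) -> lex_gt (mon j) (mon i).
Proof.
have si := mons_size (lsti_mons i); have sj := mons_size (lsti_mons j).
move=> /lgt_nth[|p []]; rewrite ?si ?sj // => pn pl pE.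
have kn : (n - p.+1 < n)%N by lia.
apply/existsP; exists (Ordinal kn); rewrite !nth_lsti /=.
have -> : (n - (n - p.+1).+1)%N = p by lia.
rewrite pl; apply/forallP => k; apply/implyP => /= kp; rewrite !nth_lsti pE //; lia.
Qed.

Lemma rgt_oplex_gt n d (i j : 'I_(size (mons n d))) :
  rgt (lsti i) (lsti j) -> oplex_gt (mon i) (mon j).
Proof.
have si := mons_size (lsti_mons i); have sj := mons_size (lsti_mons j).
move=> /rgt_nth[|p []]; rewrite ?si ?sj // => pn pl pE.
have kn : (n - p.+1 < n)%N by lia.
apply/existsP; exists (Ordinal kn); rewrite !nth_lsti /=.
have -> : (n - (n - p.+1).+1)%N = p by lia.
rewrite pl; apply/forallP => k; apply/implyP => /= kp; have kn' := ltn_ord k.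
by rewrite !nth_lsti pE //; lia.
Qed.

Section General.
Variables (K : fieldType) (n : nat).
Hypothesis charK0 : [pchar K] =i pred0.
Local Notation N d := (size (mons n d)).
Local Notation evmx g f := (f.@[fun k => mxvec g 0 k]).

Lemma meval_mxvec (g : 'M[K]_n) :
  map_mx (meval (fun k => mxvec g 0 k)) (\matrix_(i, j) 'X_(mxvec_index i j)) = g.
Proof. by apply/matrixP => i j; rewrite !mxE mevalXU mxvecE. Qed.

Lemma transverse_open d c (V W : 'M[K]_(N d)) : transverse c V W ->
  exists f : {mpoly K[n * n]}, (exists2 g : 'M[K]_n, g \in unitmx & evmx g f != 0) /\
    forall g : 'M[K]_n, evmx g f != 0 -> (c <= \rank (V + W *m rho d g)%MS)%N.
Proof.
move=> [g0 g0u cg0].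
pose C := @mpolyC (n * n) K.
pose M := col_mx (map_mx C V)
  (map_mx C W *m rho d (\matrix_(i, j) 'X_(mxvec_index i j))).
have CK (g : 'M[K]_n) : cancel C (meval (fun k => mxvec g 0 k)) by move=> x; apply: mevalC.
have ME (g : 'M[K]_n) : map_mx (meval (fun k => mxvec g 0 k)) M = col_mx V (W *m rho d g).
  have CM (A : 'M[K]_(N d)) : map_mx (meval (fun k => mxvec g 0 k)) (map_mx C A) = A.
    by apply/matrixP => i j; rewrite !mxE; apply: CK.
  by rewrite map_col_mx map_mxM /= rho_map meval_mxvec !CM.
have [f f0 fP] := rank_open (c := C) M (f0 := meval (fun k => mxvec g0 0 k)) (CK g0).
exists f; split=> [|g fg]; first by exists g0.
have := fP (meval (fun k => mxvec g 0 k)) (CK g) fg.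
by rewrite !ME -!addsmxE; apply: leq_trans.
Qed.

Lemma meval_line (f : {mpoly K[n * n]}) (G : 'M[{poly K}]_n) t :
  (mmap polyC (fun k => mxvec G 0 k) f).[t] = evmx (ev t G) f.
Proof.
rewrite /meval /mmap -[LHS]/(horner_eval t _) raddf_sum; apply: eq_bigr => m _ /=.
rewrite rmorphM /mmap1 rmorph_prod /= {1}/horner_eval hornerC; congr (_ * _).
apply: eq_bigr => i _; rewrite rmorphXn /=; congr (_ ^+ _).
by case/mxvec_indexP: i => i j; rewrite !mxvecE mxE.
Qed.

(* Join the two given matrices by a line. *)
Lemma open_meet (f1 f2 : {mpoly K[n * n]}) :
  (exists2 g : 'M[K]_n, g \in unitmx & evmx g f1 != 0) ->
  (exists2 g : 'M[K]_n, g \in unitmx & evmx g f2 != 0) ->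
  exists2 g : 'M[K]_n, g \in unitmx & evmx g (f1 * f2) != 0.
Proof.
move=> [g1 g1u f1g] [g2 g2u f2g].
pose G : 'M[{poly K}]_n := map_mx polyC g1 + 'X *: map_mx polyC (g2 - g1).
have G0 : ev 0 G = g1.
  by apply/matrixP => i j; rewrite !mxE /horner_eval hornerD hornerM !hornerC hornerX mul0r addr0.
have G1 : ev 1 G = g2.
  apply/matrixP => i j; rewrite !mxE /horner_eval hornerD hornerM !hornerC hornerX mul1r.
  by rewrite addrCA subrr addr0.
pose F f := mmap polyC (fun k => mxvec G 0 k) f : {poly K}.
have detE t : (\det G).[t] = \det (ev t G) by rewrite -[LHS]/(horner_eval t _) -det_map_mx.
have nz (p : {poly K}) t : p.[t] != 0 -> p != 0.
  by apply: contraNneq => ->; rewrite horner0.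
have d0 : \det G != 0 by apply: (nz _ 0); rewrite detE G0 -unitfE -unitmxE.
have F1 : F f1 != 0 by apply: (nz _ 0); rewrite meval_line G0.
have F2 : F f2 != 0 by apply: (nz _ 1); rewrite meval_line G1.
have [|t _] := poly_nonroot charK0 (p := \det G * (F f1 * F f2)).
  by rewrite !mulf_neq0.
rewrite !hornerM !mulf_eq0 !negb_or !meval_line detE -unitfE -unitmxE => /and3P[gu h1 h2].
by exists (ev t G); rewrite // mevalM mulf_neq0.
Qed.

Lemma open_family (f : nat -> {mpoly K[n * n]}) D :
  (forall d, exists2 g : 'M[K]_n, g \in unitmx & evmx g (f d) != 0) ->
  exists2 g : 'M[K]_n, g \in unitmx & evmx g (\prod_(d < D) f d) != 0.
Proof.
move=> fP; elim: D => [|D IH].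
  by exists 1%:M; rewrite ?unitmx1 // big_ord0 meval1 oner_neq0.
by rewrite big_ord_recr; apply: open_meet.
Qed.

(* From some degree on, the lex segments of sizes [c d] grow minimally, so by Macaulay's bound
   a lower bound on the Hilbert function propagates from one degree to the next. *)
Lemma growth_bound (c : nat -> nat) (M : {mpoly K[n]} -> Prop) : monomial_ideal M ->
  (forall d, c d = #|monset M d|) ->
  exists D, forall V : (forall d, 'M[K]_(N d)),
    (forall d k, (V d *m mulX d K k <= V d.+1)%MS) ->
    (forall d, (d < D.+1)%N -> (c d <= \rank (V d))%N) -> forall d, (c d <= \rank (V d))%N.
Proof.
move=> mM cM.
have cN d : (c d <= N d)%N by rewrite cM -[X in (_ <= X)%N]card_ord max_card.
have idM := monomial_is_ideal mM.
(* Used twice: on [M], to see that [c] grows at least as lex segments do, and on [V], to propagate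
   the bound. *)
have step (V : forall d, 'M[K]_(N d)) d : (forall k, (V d *m mulX d K k <= V d.+1)%MS) ->
    (c d <= \rank (V d))%N ->
    (cnt n d.+1 (fun l => lexseg n d (c d) (red l)) <= \rank (V d.+1))%N.
  move=> VS cV; apply: leq_trans (mxrankS (mulm_subP VS)).
  by apply: (macaulay charK0) => //; [exact: lexseg_lexset | rewrite cnt_lexseg].
have [|D DP] := @lexseg_eventually n c cN.
  move=> d; rewrite [in leqRHS]cM -(rank_dset K).
  apply: (step (fun d => dset K (monset M d))); last by rewrite rank_dset cM.
  by move=> k; apply: (component_mulX _ idM); apply: monset_component.
exists D => V VS low; elim=> [|d IH]; first exact: low.
case: (leqP D d) => Dd; last exact: low.
by rewrite DP //; apply: step.
Qed.
End General.

Theorem theorem1p3 (K : fieldType) (charK0 : [pchar K] =i pred0) (n : nat)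
    (I J Ilex Joplex GinJ : {mpoly K[n]} -> Prop)
    (homI : homogeneous_ideal I) (homJ : homogeneous_ideal J)
    (ginJ : is_gin (@lex_gt n) J GinJ) (ginJ_lex : is_lex_ideal GinJ)
    (IlexP : is_lexification I Ilex) (JoplexP : is_oplexification J Joplex) :
  for_general (fun g : 'M[K]_n => forall d : nat,
    (hilbert (ideal_inter I (ideal_image g J)) d
       <= hilbert (ideal_inter Ilex Joplex) d)%N).
Proof.
have [idI _] := homI; have [idJ _] := homJ.
have [[mL segL] HL] := IlexP; have [[mO segO] HO] := JoplexP.
have [V VP] : exists V : (forall d, 'M[K]_(size (mons n d))), forall d, component I (V d).
  pose f d := constructive_indefinite_description _ (component_ex d idI).
  by exists (fun d => proj1_sig (f d)) => d; apply: (proj2_sig (f d)).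
have [W WP] : exists W : (forall d, 'M[K]_(size (mons n d))), forall d, component J (W d).
  pose f d := constructive_indefinite_description _ (component_ex d idJ).
  by exists (fun d => proj1_sig (f d)) => d; apply: (proj2_sig (f d)).
have rV d : \rank (V d) = #|monset Ilex d|.
  by rewrite -(hilbert_monset d mL) HL (hilbert_component (VP d)).
have rW d : \rank (W d) = #|monset Joplex d|.
  by rewrite -(hilbert_monset d mO) HO (hilbert_component (WP d)).
pose c d := #|monset Ilex d :|: monset Joplex d|.
have tr d : transverse (c d) (V d) (W d).
  pose L := listp (monset Ilex d).
  have LE : [set i | L (lsti i)] = monset Ilex d by apply/setP => i; rewrite inE /L listpE.
  rewrite /c -LE; apply: (transverse_lex charK0).
  - move=> l l' /lsti_surj[i <-] /lsti_surj[j <-] ji; rewrite /L !listpE => /monsetP Li.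
    apply/monsetP; apply: (segL (mon i)) => //; first by rewrite !mdeg_mon.
    by apply: lgt_lex_gt.
  - by rewrite cnt_listp rV.
  - exact: (degen_gin charK0 homJ ginJ ginJ_lex JoplexP (WP d)).
  - move=> l l' /lsti_surj[i <-] /lsti_surj[j <-] ij; rewrite !listpE; apply: contra => /monsetP Oj.
    apply/monsetP; apply: (segO (mon j)) => //; first by rewrite !mdeg_mon.
    by apply: rgt_oplex_gt.
have [f fP] : exists f : nat -> {mpoly K[n * n]}, forall d,
    (exists2 g : 'M[K]_n, g \in unitmx & (f d).@[fun k => mxvec g 0 k] != 0) /\
    forall g : 'M[K]_n, (f d).@[fun k => mxvec g 0 k] != 0 ->
      (c d <= \rank (V d + W d *m rho d g)%MS)%N.
  pose f d := constructive_indefinite_description _ (transverse_open (tr d)).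
  by exists (fun d => proj1_sig (f d)) => d; apply: (proj2_sig (f d)).
(* This is the ideal [Ilex + Joplex], whose Hilbert function is [c]. *)
pose M (p : {mpoly K[n]}) := forall m, m \in msupp p -> Ilex 'X_[m] \/ Joplex 'X_[m].
have mM : monomial_ideal M.
  exists (fun m => Ilex 'X_[m] \/ Joplex 'X_[m]) => p.
  rewrite (mem_ideal_gen_mon _ (W := fun m => Ilex 'X_[m] \/ Joplex 'X_[m])) //.
  split=> h m /h => [Mm|[w Ww wm]]; first by exists m => //; apply: lepm_refl.
  have [_ _ LM] := monomial_is_ideal mL; have [_ _ OM] := monomial_is_ideal mO.
  by rewrite -(submK wm) mpolyXD; case: Ww => ?; [left; apply: LM | right; apply: OM].
have cM d : c d = #|monset M d|.
  congr #|pred_of_set _|; apply/setP => i; rewrite in_setU; apply/orP/monsetP => [h m|h].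
    by rewrite msuppX inE => /eqP->; case: h => /monsetP; [left | right].
  have mi : mon i \in msupp ('X_[mon i] : {mpoly K[n]}) by rewrite msuppX inE.
  by case: (h _ mi) => ?; [left | right]; apply/monsetP.
have [D DP] := growth_bound charK0 mM cM.
(* The bound has to be imposed in the degrees 0 to [D] inclusive. *)
pose F := \prod_(d < D.+1) f d.
exists (fun g => g \in unitmx /\ F.@[fun k => mxvec g 0 k] != 0); split.
- exists (fun p => p = F) => g; split=> [[gu Fg]|[gu [_ -> Fg]]] //.
  by split=> //; exists F.
- have [g gu Fg] := open_family charK0 D.+1 (fun d => (fP d).1).
  by exists g.
move=> g [gu Fg] d.
have gJ d' := image_component gu homJ (WP d').
have idgJ : is_ideal (ideal_image g J) by apply: image_ideal.
rewrite (hilbert_component (component_cap (VP d) (gJ d))).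
rewrite (hilbert_component (component_cap (monset_component mL) (monset_component mO))).
rewrite rank_dset_cap.
have low : (c d <= \rank (V d + W d *m rho d g)%MS)%N.
  apply: (DP (fun d => V d + W d *m rho d g)%MS) => [d' k|d' d'D].
    rewrite addsmxMr addsmx_sub; apply/andP; split.
      exact: submx_trans (component_mulX k idI (VP d') (VP d'.+1)) (addsmxSl _ _).
    exact: submx_trans (component_mulX k idgJ (gJ d') (gJ d'.+1)) (addsmxSr _ _).
  apply: (fP d').2; apply: contraNneq Fg => f0.
  by rewrite /F rmorph_prod (bigD1 (Ordinal d'D)) //= f0 mul0r.
(* The dimension formulas on the two sides have the same total, so the larger sum leaves the smaller
   intersection. *)
have := mxrank_sum_cap (V d) (W d *m rho d g); rewrite rank_rho // rV rW.
have := cardsUI (monset Ilex d) (monset Joplex d); rewrite -/(c d).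
lia.
Qed.
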